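(* Let $n\ge2$. For each local field $K$ and each polynomial curve $\gamma\in K[T]^n$, $$\mathrm{H}_\gamma(W)\ge (n!)^{1/2n}.$$
   Context: A local field $K$ is $\mathbb{R}$, $\mathbb{C}$ or a non-Archimedean local field, with a fixed absolute value $|\cdot|$: the usual one on $\mathbb{R}$; $|x+iy|=\max\{|x|,|y|\}$ on $\mathbb{C}$; a fixed absolute value defining the topology, with uniformizer $\pi$, in the non-Archimedean case. On $K^n$, $|\boldsymbol{x}|=\max_i|x_i|$. Ring of integers / unit cell: $\mathfrak{o}=\{x\in K:|x|\le 1\}$ if $K$ is non-Archimedean, with maximal ideal $\mathfrak{p}=\{x:|x|<1\}$; $\mathfrak{o}=[0,1]$ if $K=\mathbb{R}$; $\mathfrak{o}=\{x+iy:x,y\in[0,1]\}$ if $K=\mathbb{C}$. Haar measure on $K$ is normalized so that $\mathfrak{o}$ has measure $1$. Scales: $\mathcal{R}(K)=\{|\pi|^s:s\in\mathbb{Z}_{\ge0}\}$ for $K$ non-Archimedean; $\mathcal{R}(\mathbb{R})=\mathcal{R}(\mathbb{C})=\{R^{-1}:R\in\mathbb{N}\}$ (with $R\ge 1$). For $\delta\in\mathcal{R}(K)$, $\mathcal{P}_\delta$ is the partition of $\mathfrak{o}$ (up to a null set) into: balls of radius $\delta=|\pi|^s$, i.e. cosets $i+\mathfrak{p}^s$, $i\in\mathfrak{o}/\mathfrak{p}^s$, if $K$ is non-Archimedean; the intervals $[j\delta,(j+1)\delta)$, $0\le j\le\delta^{-1}-1$, if $K=\mathbb{R}$; the squares $[j\delta,(j+1)\delta)+i[k\delta,(k+1)\delta)$,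 $0\le j,k\le\delta^{-1}-1$, if $K=\mathbb{C}$. Additive character $e(\cdot)$: $e(t)=e^{-2\pi it}$ on $\mathbb{R}$; $e(z)=e^{-2\pi i\,\mathrm{Re}\,z}$ on $\mathbb{C}$; for $K$ non-Archimedean, a fixed non-trivial additive character with $e\equiv1$ on $\mathfrak{o}$ and $e(1/\pi)\ne1$. Admissible functions $f:K\to\mathbb{C}$ are compactly supported, measurable and integrable on $\mathfrak{o}$. For $I\subset\mathfrak{o}$ measurable, $E_If(\boldsymbol{x})=\int_I f(\xi)\,e(\gamma(\xi)\cdot\boldsymbol{x})\,d\xi$ for $\boldsymbol{x}\in K^n$, where $\gamma(\xi)\cdot\boldsymbol{x}=\sum_i\gamma_i(\xi)x_i$. The square function is $S_\delta f(\boldsymbol{x})=\big(\sum_{J\in\mathcal{P}_\delta}|E_Jf(\boldsymbol{x})|^2\big)^{1/2}$. Weight $W$: fix a non-negative Schwartz function $w:\mathbb{R}\to\mathbb{R}$ that is at least $1$ on $[0,1]$ and whose Fourier transform $\widehat{w}(\xi)=\int w(x)e^{-2\pi ix\xi}dx$ is non-negative and supported on $[-1,1]$. If $K=\mathbb{R}$, $W(\boldsymbol{x})=w(x_1)\cdots w(x_n)$; if $K=\mathbb{C}$, $W(\boldsymbol{x}+i\boldsymbol{y})=W(\boldsymbol{x})W(\boldsymbol{y})$ for $\boldsymbol{x},\boldsymbol{y}\in\mathbb{R}^n$ (using the real $W$ on the right); if $K$ is non-Archimedean, $W=\mathbf{1}_{\{|\boldsymbol{z}|\le1\}}$ on $K^n$.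 For $\boldsymbol{c}\in K^n$ and $r=\delta^{-n}$, $W_{\boldsymbol{c},r}(\boldsymbol{x})=W((\boldsymbol{x}-\boldsymbol{c})/r)$ if $K$ is $\mathbb{R}$ or $\mathbb{C}$, and $W_{\boldsymbol{c},r}(\boldsymbol{x})=W((\boldsymbol{x}-\boldsymbol{c})/R)$ with $R\in K$, $|R|=r$, if $K$ is non-Archimedean (so it is the indicator of $\{|\boldsymbol{x}-\boldsymbol{c}|\le r\}$). $\|g\|_{L^{2n}(W_{\boldsymbol{c},r})}=\big(\int_{K^n}|g|^{2n}W_{\boldsymbol{c},r}\,d\boldsymbol{x}\big)^{1/2n}$. $\mathrm{H}_\gamma(W)=\sup_{\delta\in\mathcal{R}(K)}\sup_{\boldsymbol{c}\in K^n}\sup_f\ \|E_{\mathfrak{o}}f\|_{L^{2n}(W_{\boldsymbol{c},\delta^{-n}})}/\|S_\delta f\|_{L^{2n}(W_{\boldsymbol{c},\delta^{-n}})}$, the supremum being over admissible $f$ with non-zero denominator. *)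

(* Defs.v *)
From HB Require Import structures.
From mathcomp Require Import all_boot all_order all_algebra.
From mathcomp Require Import all_classical all_reals all_analysis.
From mathcomp Require Import complex.

Set Implicit Arguments.
Unset Strict Implicit.
Unset Printing Implicit Defensive.

Import Order.TTheory GRing.Theory Num.Theory.
Import numFieldNormedType.Exports.

Local Open Scope classical_set_scope.
Local Open Scope ring_scope.
Local Open Scope complex_scope.

Definition cmod (R : realType) (z : R[i]) : R := ComplexField.Normc.normc z.

Definition Cintegral d (T : measurableType d) (R : realType)
    (mu : {measure set T -> \bar R}) (D : set T) (f : T -> R[i]) : R[i] :=
  (\int[mu]_(x in D) complex.Re (f x)) +i* (\int[mu]_(x in D) complex.Im (f x)).

Record ultrametricField (R : realType) := UltrametricField {
  uf_field :> fieldType;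
  uf_abs : uf_field -> R;
  uf_abs_ge0 : forall x, 0 <= uf_abs x;
  uf_abs_eq0 : forall x, (uf_abs x == 0) = (x == 0);
  uf_absM : forall x y, uf_abs (x * y) = uf_abs x * uf_abs y;
  uf_absD : forall x y, uf_abs (x + y) <= Num.max (uf_abs x) (uf_abs y) }.

(* The carrier with the metric |x - y|, its topology and its Borel sets. *)
Definition ultrametric_space (R : realType) (K : ultrametricField R) : Type := K.

Section UltrametricSpace.
Context {R : realType} (K : ultrametricField R).
Implicit Types x y z : K.

Let dist x y : R := uf_abs (x - y).

Let dist0 x : dist x x = 0.
Proof. by apply/eqP; rewrite uf_abs_eq0 subrr. Qed.

Let dist_eq0 x y : dist x y = 0 -> x = y.
Proof. by move/eqP; rewrite uf_abs_eq0 subr_eq0 => /eqP. Qed.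

Let dist_sym x y : dist x y = dist y x.
Proof.
have abs1 : uf_abs (1 : K) = 1.
  have nz1 : uf_abs (1 : K) != 0 by rewrite uf_abs_eq0 oner_eq0.
  by apply: (mulfI nz1); rewrite -uf_absM !mulr1.
have absN1 : uf_abs (-1 : K) = 1.
  apply/eqP; rewrite -[_ == _](@pexpr_eq1 _ _ 2)// ?uf_abs_ge0//.
  by rewrite expr2 -uf_absM mulrNN mulr1 abs1.
by rewrite /dist -(opprB y x) -mulN1r uf_absM absN1 mul1r.
Qed.

Let dist_triangle y x z : dist x z <= dist x y + dist y z.
Proof.
rewrite /dist -(subrKA y x (- z)) (le_trans (uf_absD _ _))//.
by rewrite ge_max lerDl lerDr !uf_abs_ge0.
Qed.

HB.instance Definition _ := Choice.copy (ultrametric_space K) K.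
HB.instance Definition _ := isPointed.Build (ultrametric_space K) (0 : K).
HB.instance Definition _ := isMetric.Build R (ultrametric_space K)
  dist0 dist_eq0 dist_sym dist_triangle.
HB.instance Definition _ := Measurable.copy (ultrametric_space K)
  (g_sigma_algebraType (@open (ultrametric_space K))).

End UltrametricSpace.

(* A field complete with respect to a non-trivial discrete absolute value, with
   finite residue field; [na_pi] is the chosen uniformizer. *)
Record nonarchLocalField (R : realType) := NonarchLocalField {
  na_field :> ultrametricField R;
  na_complete : forall F : set_system (ultrametric_space na_field),
    ProperFilter F -> cauchy F -> cvg F;
  na_pi : na_field;
  na_pi_gt0 : 0 < uf_abs na_pi;
  na_pi_lt1 : uf_abs na_pi < 1;
  na_discrete : forall x : na_field, x != 0 ->
    exists z : int, uf_abs x = uf_abs na_pi ^ z;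
  na_residue_finite : exists s : seq na_field, forall x : na_field,
    uf_abs x <= 1 -> exists2 y, y \in s & uf_abs (x - y) < 1 }.

Definition ring_of_integers (R : realType) (K : ultrametricField R) : set K :=
  [set x | uf_abs x <= 1].

Definition normalized_haar (R : realType) (K : ultrametricField R)
    (mu : {measure set (ultrametric_space K) -> \bar R}) : Prop :=
  (forall (a : K) (A : set (ultrametric_space K)), measurable A ->
    mu [set (a + x : K) | x in A] = mu A) /\
  mu (ring_of_integers (K := K)) = 1%E.

(* The last two conditions make [o] the largest ball on which [e] is trivial. *)
Definition normalized_character (R : realType) (K : nonarchLocalField R)
    (e : K -> R[i]) : Prop :=
  [/\ forall x y, e (x + y) = e x * e y,
      forall x, cmod (e x) = 1,
      continuous (e : ultrametric_space K -> R[i]^o),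
      forall x, uf_abs x <= 1 -> e x = 1
    & e (na_pi K)^-1 != 1].

Variant local_field (R : realType) : Type :=
| LFReal
| LFComplex
| LFNonarch (K : nonarchLocalField R)
    (mu : {measure set (ultrametric_space K) -> \bar R}) (e : K -> R[i])
    of normalized_haar mu & normalized_character e.

(* Borel sets of the complex plane, identified with those of R x R. *)
Definition complex_space (R : realType) : Type := R[i].

HB.instance Definition _ (R : realType) := Choice.copy (complex_space R) R[i].
HB.instance Definition _ (R : realType) := isPointed.Build (complex_space R) (0 : R[i]).

Definition re_im (R : realType) (z : complex_space R) :
    measurableTypeR R * measurableTypeR R := (complex.Re z, complex.Im z).

HB.instance Definition _ (R : realType) :=
  Measurable.copy (complex_space R) (g_sigma_algebra_preimageType (@re_im R)).

Definition complex_lebesgue (R : realType) (A : set (complex_space R)) : \bar R :=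
  (@lebesgue_measure R \x @lebesgue_measure R)%E [set p | A (p.1 +i* p.2)].

Section ComplexLebesgue.
Context {R : realType}.
Implicit Types A : set (complex_space R).

Let measurable_square A : measurable A ->
  measurable ([set p | A (p.1 +i* p.2)] : set (measurableTypeR R * measurableTypeR R)).
Proof.
case=> B mB <-; rewrite setTI; rewrite (_ : [set p | _] = B)//.
by apply/seteqP; split=> -[].
Qed.

Let mu0 : complex_lebesgue (set0 : set (complex_space R)) = 0%E.
Proof. exact: measure0. Qed.

Let mu_ge0 A : (0 <= complex_lebesgue A)%E.
Proof. exact: measure_ge0. Qed.

Let mu_sigma_additive : semi_sigma_additive (@complex_lebesgue R).
Proof.
move=> F mF tF mUF.
have -> : complex_lebesgue (\bigcup_n F n) =
    (@lebesgue_measure R \x @lebesgue_measure R)%E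
      (\bigcup_n [set p | F n (p.1 +i* p.2)]).
  by congr (_ \x _)%E; apply/seteqP; split.
apply: measure_semi_sigma_additive.
- by move=> n; exact: measurable_square.
- apply/trivIsetP => i j _ _ ij.
  move/trivIsetP : tF => /(_ _ _ Logic.I Logic.I ij) /seteqP[/= h _].
  by apply/seteqP; split => // p hp; exact: (h (p.1 +i* p.2)).
- exact: measurable_square mUF.
Qed.

HB.instance Definition _ := isMeasure.Build _ _ _ (@complex_lebesgue R)
  mu0 mu_ge0 mu_sigma_additive.

End ComplexLebesgue.

Record field_data (R : realType) := FieldData {
  fd_field : fieldType;
  fd_display : measure_display;
  fd_measurable : Measurable.axioms_ fd_display fd_field;
  fd_topology : Topological.axioms_ fd_field;
  fd_haar : {measure set (Measurable.Pack fd_measurable) -> \bar R};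
  fd_cell : set fd_field;
  fd_scales : set R;
  fd_partition : R -> set (set fd_field);
  fd_char : fd_field -> R[i];
  (* For [r > 0] in the value group, a scalar of absolute value [r]; in the
     non-Archimedean case it is only determined up to a unit, on which
     [fd_weight] does not depend. *)
  fd_scalar : R -> fd_field;
  (* Takes the auxiliary function on the real line, ignored in the
     non-Archimedean case. *)
  fd_weight : (R -> R) -> forall n, n.-tuple fd_field -> R }.

Arguments fd_haar {R} f.
Arguments fd_cell {R} f.
Arguments fd_partition {R} f.
Arguments fd_char {R} f.
Arguments fd_weight {R} f w {n}.

Section LocalFieldData.
Context {R : realType}.

Definition real_char (t : R) : R[i] :=
  cos (2 * pi * t) -i* sin (2 * pi * t).

Definition real_weight (w : R -> R) n (x : n.-tuple R) : R :=
  \prod_(i < n) w (tnth x i).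

Definition archimedean_scales : set R := [set N%:R^-1 | N in [set N : nat | (0 < N)%N]].

Definition real_partition (delta : R) : set (set R) :=
  [set `[j%:R * delta, j.+1%:R * delta[%classic
    | j in [set j : nat | j%:R <= delta^-1 - 1]].

Definition real_data : field_data R := {|
  fd_measurable := Measurable.class (measurableTypeR R) :
    Measurable.axioms_ _ (R : fieldType);
  fd_topology := Topological.class R^o : Topological.axioms_ (R : fieldType);
  fd_haar := @lebesgue_measure R;
  fd_cell := `[0, 1]%classic;
  fd_scales := archimedean_scales;
  fd_partition := real_partition;
  fd_char := real_char;
  fd_scalar := id;
  fd_weight := real_weight |}.

Definition complex_data : field_data R := {|
  fd_measurable := Measurable.class (complex_space R) :
    Measurable.axioms_ _ (R[i] : fieldType);
  fd_topology := Topological.class R[i]^o : Topological.axioms_ (R[i] : fieldType);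
  fd_haar := @complex_lebesgue R;
  fd_cell := [set z | 0 <= complex.Re z <= 1 /\ 0 <= complex.Im z <= 1];
  fd_scales := archimedean_scales;
  fd_partition := fun delta =>
    [set [set z | I (complex.Re z) /\ J (complex.Im z)]
      | I in real_partition delta & J in real_partition delta];
  fd_char := fun z => real_char (complex.Re z);
  fd_scalar := fun r => r%:C;
  fd_weight := fun w n z =>
    real_weight w [tuple complex.Re (tnth z i) | i < n] *
    real_weight w [tuple complex.Im (tnth z i) | i < n] |}.

Definition nonarch_data (K : nonarchLocalField R)
    (mu : {measure set (ultrametric_space K) -> \bar R}) (e : K -> R[i]) :
    field_data R := {|
  fd_measurable := Measurable.class (ultrametric_space K) :
    Measurable.axioms_ _ (K : fieldType);
  fd_topology := Topological.class (ultrametric_space K) :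
    Topological.axioms_ (K : fieldType);
  fd_haar := mu;
  fd_cell := ring_of_integers (K := K);
  fd_scales := range (fun s : nat => uf_abs (na_pi K) ^+ s);
  fd_partition := fun delta =>
    [set [set x : K | uf_abs (x - i) <= delta] | i in ring_of_integers (K := K)];
  fd_char := e;
  fd_scalar := fun r => xget 1 [set a : K | uf_abs a = r];
  fd_weight := fun _ n z => \1_[set z : n.-tuple K | forall i, uf_abs (tnth z i) <= 1] z |}.

Definition data_of (K : local_field R) : field_data R :=
  match K with
  | LFReal => real_data
  | LFComplex => complex_data
  | LFNonarch K mu e _ _ => nonarch_data mu e
  end.

End LocalFieldData.

(* The field underlying [K], and the same carrier as a Borel space and as a
   topological space. *)
Definition lf_field (R : realType) (K : local_field R) : fieldType :=
  fd_field (data_of K).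
Coercion lf_field : local_field >-> GRing.Field.type.

Definition lf_space (R : realType) (K : local_field R) : measurableType _ :=
  Measurable.Pack (fd_measurable (data_of K)).

Definition lf_top (R : realType) (K : local_field R) : topologicalType :=
  Topological.Pack (fd_topology (data_of K)).

Section SquareFunction.
Context {R : realType} (K : local_field R).

Definition haar : {measure set (lf_space K) -> \bar R} := fd_haar (data_of K).

(* The product Haar measure on [K^n]; the library's product of two measures is
   defined on bare set functions. *)
Fixpoint haar_power n : set (n.-tuple (lf_space K)) -> \bar R :=
  match n with
  | 0 => \d_[tuple]
  | m.+1 => fun A =>
      (haar \x @haar_power m)%E
        [set p : lf_space K * m.-tuple (lf_space K) | A [tuple of p.1 :: p.2]]
  end.

Definition admissible (f : K -> R[i]) : Prop :=
  [/\ compact (closure ([set xi | f xi != 0] : set (lf_top K))),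
      measurable_fun setT ((fun xi => complex.Re (f xi)) : lf_space K -> R),
      measurable_fun setT ((fun xi => complex.Im (f xi)) : lf_space K -> R),
      haar.-integrable (fd_cell (data_of K)) (fun xi => (complex.Re (f xi))%:E)
    & haar.-integrable (fd_cell (data_of K)) (fun xi => (complex.Im (f xi))%:E)].

Context {n : nat} (gamma : n.-tuple {poly K}).

Definition extension (I : set K) (f : K -> R[i]) (x : n.-tuple K) : R[i] :=
  Cintegral haar I (fun xi : lf_space K =>
    f xi * fd_char (data_of K) (\sum_(i < n) (tnth gamma i).[xi] * tnth x i)).

Definition square_function (delta : R) (f : K -> R[i]) (x : n.-tuple K) : R :=
  Num.sqrt (\sum_(J \in fd_partition (data_of K) delta)
    cmod (extension J f x) ^+ 2).

Definition dilated_weight (w : R -> R) (c : n.-tuple K) (r : R) (x : n.-tuple K) : R :=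
  fd_weight (data_of K) w
    [tuple (tnth x i - tnth c i) / fd_scalar (data_of K) r | i < n].

(* The norm of L^{2n}(V dx), for a function given by its modulus [g]. *)
Definition weighted_norm (V g : n.-tuple K -> R) : \bar R :=
  ((\int[@haar_power n]_(x in [set: n.-tuple (lf_space K)])
     (g x ^+ (2 * n) * V x)%:E) `^ (2 * n)%:R^-1)%E.

(* For admissible [f] both norms are finite, so the quotient of extended reals
   is a quotient of real numbers. *)
Definition square_function_constant (w : R -> R) : \bar R :=
  ereal_sup [set h | exists delta c f,
    let N := weighted_norm (dilated_weight w c (delta ^- n)) in
    let num := N (fun x => cmod (extension (fd_cell (data_of K)) f x)) in
    let den := N (square_function delta f) in
    [/\ fd_scales (data_of K) delta, admissible f, den != 0%E
      & h = (num / den)%E]].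

End SquareFunction.

Section AuxiliaryFunction.
Context {R : realType}.

Definition schwartz (w : R -> R) : Prop :=
  (forall k x, derivable (derive1n k w) x 1) /\
  (forall k m : nat, exists C : R, forall x, `|x| ^+ m * `|derive1n k w x| <= C).

Definition fourier (w : R -> R) (xi : R) : R[i] :=
  Cintegral (@lebesgue_measure R) setT (fun x => (w x)%:C * real_char (x * xi)).

(* [0 <= z] in [R[i]] says that [z] is a non-negative real number. *)
Definition weight_generator (w : R -> R) : Prop :=
  [/\ schwartz w,
      forall x, 0 <= w x,
      forall x, 0 <= x <= 1 -> 1 <= w x,
      forall xi, 0 <= fourier w xi
    & forall xi, 1 < `|xi| -> fourier w xi = 0].

End AuxiliaryFunction.

(* Main.v *)
Require Import Defs.
From HB Require Import structures.
From mathcomp Require Import all_boot all_order all_algebra.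
From mathcomp Require Import all_classical all_reals all_analysis.
From mathcomp Require Import finmap complex measurable_realfun cyclic separable cyclotomic.
From mathcomp Require Import ring lra zify.

Set Implicit Arguments.
Unset Strict Implicit.
Unset Printing Implicit Defensive.

Import Order.TTheory GRing.Theory Num.Theory.
Import numFieldNormedType.Exports.

Local Open Scope classical_set_scope.
Local Open Scope ring_scope.

(** The square function does not see the phases of the pieces [E_J f], while the
    extension operator does, so the idea is to choose these phases at random.

    Let [delta] be a scale with [N] pieces [J], and in every piece choose a point
    [xi_J] together with a small set around it.  A test function which is the
    normalized indicator of these small sets, multiplied by a phase [eps_J] on
    each of them, has [E_J f (x)] close to [eps_J * e(gamma(xi_J) . x)], uniformly
    for [x] in any given box.  Hence the square function is essentially [sqrt N]
    and its [2n]-th power is at most [N ^ n] everywhere, whatever the phases are.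
    On the other hand, the mean over independent phases of
    [|sum_J eps_J z_J| ^ (2n)] with [|z_J| = 1] is at least
    [n! * N (N - 1) ... (N - n + 1)] ([moment_phase_vectors]): when the power is
    expanded, the terms that survive the mean are indexed by the pairs of maps
    from [n] letters to the pieces that differ by a permutation of the letters,
    and this number counts the pairs of injective maps.
    Integrating against the weight and exchanging the sum over phases with the
    integral ([exists_ge_average]), some choice of phases does at least as well
    as the mean.  The quotient of the [2n]-th powers of the two norms is thus at
    least [n! * (N)_n / N ^ n] up to an arbitrarily small error, and this tends
    to [n!] as [delta] tends to [0].

    Two devices keep the analysis light.  The phases are roots of unity of an
    order larger than [n], which makes the mean a finite sum.  The
    function [E_J f] is compared pointwise with an explicit exponential sum, and
    the integral of non-negative functions is monotone without measurability
    ([ge0_le_integral_nonmeasurable]), so that no joint measurability or Fubini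
    argument for the extension operator is involved.

    The three kinds of local fields are treated together: [tame_field] lists what
    the argument uses, [tame_square_function_constant] derives the bound from
    it, and [tame_real], [tame_complex] and [tame_nonarch] verify it.  In the
    non-Archimedean case the work lies in finiteness statements (the ring of
    integers is compact, balls have finite positive measure, partitions are
    finite), all of which follow from the covering of the ring of integers by
    finitely many small balls, [ring_of_integers_covering]. *)

(** * Moments of sums with random phases *)

Section Moments.
Context {C : numClosedFieldType}.
Implicit Types (M N n : nat) (z : nat -> C) (eps : seq C).

(** Over a closed field of characteristic zero [X ^ M - 1] is separable, so it has
    [M] distinct roots, and the group they form is cyclic. *)
Lemma closed_prim_root_exists M : (0 < M)%N -> exists zeta : C, M.-primitive_root zeta.
Proof.
move=> M_gt0; pose p : {poly C} := 'X^M - 1.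
have [r Dp] := closed_field_poly_normal p.
rewrite (monicP _) ?monicXnsubC // scale1r in Dp.
have rn1 : all M.-unity_root r by apply/allP=> u; rewrite -root_prod_XsubC -Dp.
have sz_r : (M < (size r).+1)%N by rewrite -(size_prod_XsubC r id) -Dp size_XnsubC.
have [|u] := hasP (has_prim_root M_gt0 rn1 _ sz_r); last by exists u.
by rewrite -separable_prod_XsubC -Dp separable_Xn_sub_1 // pnatr_eq0 -lt0n.
Qed.

Lemma norm_prim_root M (zeta : C) : M.-primitive_root zeta -> `|zeta| = 1.
Proof.
move=> zP; have M0 := prim_order_gt0 zP.
by apply/eqP; rewrite -(@pexpr_eq1 _ _ M)// -normrX prim_expr_order// normr1.
Qed.

Lemma sum_powers_prim_root M (zeta : C) k l : M.-primitive_root zeta ->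
  (k < M)%N -> (l < M)%N ->
  \sum_(i < M) (zeta ^+ i) ^+ k * ((zeta ^+ i) ^+ l)^* = M%:R *+ (k == l).
Proof.
move=> zP kM lM; have z1 := norm_prim_root zP.
pose q := zeta ^+ k * (zeta ^+ l)^*.
have -> : \sum_(i < M) (zeta ^+ i) ^+ k * ((zeta ^+ i) ^+ l)^* = \sum_(i < M) q ^+ i.
  by apply: eq_bigr => i _; rewrite /q exprMn -rmorphXn/= -!exprM [(i * k)%N]mulnC [(i * l)%N]mulnC.
have zl : zeta ^+ l * (zeta ^+ l)^* = 1 by rewrite -normCK normrX z1 !expr1n.
have [kl|kl] := eqVneq k l.
  rewrite /q kl zl (eq_bigr (fun=> 1)); first by rewrite sumr_const card_ord mulr1n.
  by move=> i _; rewrite expr1n.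
have q1 : q != 1.
  apply: contraNneq kl => q1.
  have : zeta ^+ k = zeta ^+ l.
    by rewrite -[LHS]mulr1 -zl [zeta ^+ l * _]mulrC mulrA -/q q1 mul1r.
  by move/eqP; rewrite (eq_prim_root_expr zP) !modn_small.
have := subrX1 q M.
have -> : q ^+ M = 1.
  rewrite exprMn -rmorphXn/= -!exprM ![(_ * M)%N]mulnC !exprM.
  by rewrite (prim_expr_order zP) !expr1n conjC1 mulr1.
rewrite subrr => /esym/eqP; rewrite mulf_eq0 subr_eq0 (negbTE q1)/= => /eqP ->.
by rewrite mulr0n.
Qed.

(** Parseval on the group of [M]-th roots of unity, whose characters are the powers
    of degree less than [M]. *)
Lemma sum_norm_poly_roots M (zeta : C) m (c : nat -> C) :
  M.-primitive_root zeta -> (m <= M)%N ->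
  \sum_(i < M) `|\sum_(k < m) c k * (zeta ^+ i) ^+ k| ^+ 2 =
    M%:R * \sum_(k < m) `|c k| ^+ 2.
Proof.
move=> zP mM.
transitivity (\sum_(k < m) \sum_(l < m) c k * (c l)^* *
    \sum_(i < M) (zeta ^+ i) ^+ k * ((zeta ^+ i) ^+ l)^*).
  under eq_bigr do rewrite normCK rmorph_sum/= mulr_suml.
  rewrite exchange_big/=; apply: eq_bigr => k _.
  under eq_bigr do rewrite mulr_sumr.
  rewrite exchange_big/=; apply: eq_bigr => l _.
  by rewrite mulr_sumr; apply: eq_bigr => i _; rewrite rmorphM/= mulrACA.
rewrite mulr_sumr; apply: eq_bigr => k _.
rewrite (bigD1 k)//= [X in _ + X]big1 ?addr0 => [|l lk].
  rewrite sum_powers_prim_root ?(leq_trans (ltn_ord _))// eqxx mulr1n normCK.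
  by rewrite mulrC.
rewrite sum_powers_prim_root ?(leq_trans (ltn_ord _))//.
by rewrite eq_sym (val_eqE l k) (negbTE lk) mulr0n mulr0.
Qed.

(** Expand [(u a + d) ^ n] in powers of [u] and keep the first two coefficients
    in Parseval's identity.  The two kept terms are exactly what the recurrence
    for falling factorials requires. *)
Lemma sum_norm_affine_roots M (zeta : C) n (d a : C) :
  M.-primitive_root zeta -> (n < M)%N -> (0 < n)%N -> `|a| = 1 ->
  M%:R * (`|d| ^+ (2 * n) + n%:R ^+ 2 * `|d| ^+ (2 * n.-1)) <=
    \sum_(i < M) `|zeta ^+ i * a + d| ^+ (2 * n).
Proof.
case: n => // n zP nM _ a1.
pose c k := d ^+ (n.+1 - k) * a ^+ k *+ 'C(n.+1, k).
have -> : \sum_(i < M) `|zeta ^+ i * a + d| ^+ (2 * n.+1) =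
    \sum_(i < M) `|\sum_(k < n.+2) c k * (zeta ^+ i) ^+ k| ^+ 2.
  apply: eq_bigr => i _; rewrite mulnC exprM -normrX addrC exprDn.
  congr (`| _ | ^+ 2); apply: eq_bigr => k _.
  by rewrite /c exprMn mulrnAl -mulrA [a ^+ k * _]mulrC.
rewrite sum_norm_poly_roots// ler_pM2l; last by rewrite ltr0n (leq_trans _ nM).
rewrite !big_ord_recl/= addrA; apply: ler_wpDr.
  by apply: sumr_ge0 => i _; rewrite exprn_ge0.
rewrite /c /bump/= subn0 bin0 !expr0 mulr1 mulr1n bin1 !expr1 subSS subn0.
rewrite normrMn normrM a1 mulr1 !normrX -[X in _ <= _ + X ^+ _]mulr_natl exprMn.
by rewrite -!exprM !(mulnC 2).
Qed.

(** All vectors of length [N] with entries among the powers of [zeta], as a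
    sequence: a normalized sum over it is an expectation over independent phases. *)
Fixpoint phase_vectors M (zeta : C) N : seq (seq C) :=
  if N is N'.+1 then
    [seq u :: eps | u <- [seq zeta ^+ i | i <- iota 0 M],
                    eps <- phase_vectors M zeta N']
  else [:: [::]].

Lemma norm_phase_vectors M (zeta : C) N eps j : M.-primitive_root zeta ->
  eps \in phase_vectors M zeta N -> (j < N)%N -> `|eps`_j| = 1.
Proof.
move=> zP; elim: N eps j => //= N IH eps [|j] /allpairsP[[u s]/= [+ sN ->]]/=.
  by move=> /mapP[i _ ->] _; rewrite normrX (norm_prim_root zP) expr1n.
by move=> _; exact: IH.
Qed.

Lemma size_phase_vectors M (zeta : C) N :
  size (phase_vectors M zeta N) = (M ^ N)%N.
Proof.
by elim: N => //= N IH; rewrite size_allpairs size_map size_iota IH expnS.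
Qed.

(** Induction on [N], averaging over the first phase: by [sum_norm_affine_roots]
    the bound [m n N] for the mean satisfies
    [m n N.+1 >= m n N + n ^ 2 * m n.-1 N], and [n! * (N)_n] solves this
    recurrence with equality. *)
Lemma moment_phase_vectors M (zeta : C) N n z :
  M.-primitive_root zeta -> (n < M)%N -> (forall j, (j < N)%N -> `|z j| = 1) ->
  (M ^ N * (n`! * N ^_ n))%:R <=
    \sum_(eps <- phase_vectors M zeta N) `|\sum_(j < N) eps`_j * z j| ^+ (2 * n).
Proof.
move=> zP; elim: N n z => [|N IH] n z nM z1.
  rewrite big_seq1 big_ord0; case: n nM => [|n] _.
    by rewrite normr0 expr0.
  by rewrite !muln0 exprn_ge0.
have M0 : 0 < M%:R :> C by rewrite ltr0n (leq_ltn_trans _ nM).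
rewrite /= big_allpairs_dep exchange_big/=.
pose D eps := \sum_(j < N) eps`_j * z j.+1.
have step eps : \sum_(u <- [seq zeta ^+ i | i <- iota 0 M])
     `|\sum_(j < N.+1) (u :: eps)`_j * z j| ^+ (2 * n) =
   \sum_(i < M) `|zeta ^+ i * z 0%N + D eps| ^+ (2 * n).
  rewrite big_map -{1}[M]subn0 -/(index_iota 0 M) big_mkord.
  by apply: eq_bigr => i _; rewrite big_ord_recl.
under eq_bigr do rewrite step.
case: n nM step => [|n] nM _.
  rewrite (eq_bigr (fun=> M%:R)) => [|eps _]; last first.
    rewrite (eq_bigr (fun=> 1)); first by rewrite sumr_const card_ord.
    by move=> i _; rewrite expr0.
  rewrite big_const_seq count_predT iter_addr_0 size_phase_vectors.
  by rewrite fact0 ffactn0 !muln1 expnS natrM mulr_natr.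
apply: (@le_trans _ _ (\sum_(eps <- phase_vectors M zeta N)
    M%:R * (`|D eps| ^+ (2 * n.+1) + n.+1%:R ^+ 2 * `|D eps| ^+ (2 * n)))).
  rewrite -mulr_sumr big_split/= -mulr_sumr.
  apply: (@le_trans _ _ (M%:R * ((M ^ N * (n.+1`! * N ^_ n.+1))%:R +
      n.+1%:R ^+ 2 * (M ^ N * (n`! * N ^_ n))%:R))).
    rewrite -natrX -!natrM -natrD -natrM ler_nat ffactSS ffactnSr expnS factS.
    have [nN|Nn] := leqP n N; last by rewrite ffact_small// !muln0.
    by rewrite -{2}(subnKC nN); nia.
  rewrite ler_pM2l// lerD//.
    by apply: (IH n.+1 (z \o S)) => // j jN; exact: z1.
  by rewrite ler_pM2l ?exprn_gt0// ?ltr0n//; apply: (IH n (z \o S)) => [|j jN]; [exact: ltnW|exact: z1].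
apply: ler_sum => eps _.
by apply: sum_norm_affine_roots => //; exact: z1.
Qed.

End Moments.

(** * The product Haar measure *)

Section Monotone.
Context d (T : measurableType d) (R : realType).
Implicit Types (f g : T -> \bar R).
Local Open Scope ereal_scope.

(** The integral of a non-negative function is a supremum over the simple
    functions below it, whether or not it is measurable. *)
Lemma ge0_le_integral_nonmeasurable (mu : {measure set T -> \bar R}) f g :
  (forall x, 0 <= f x) -> (forall x, f x <= g x) ->
  \int[mu]_x f x <= \int[mu]_x g x.
Proof.
move=> f0 fg; have g0 x : 0 <= g x by exact: le_trans (fg x).
rewrite !ge0_integralTE//; apply: le_ereal_sup => _ [h hf <-].
by exists h => // x; exact: le_trans (hf x) (fg x).
Qed.

End Monotone.

Section SigmaFinite.
Context d (T : measurableType d) (R : realType).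
Variables (mu : {measure set T -> \bar R}) (sf : sigma_finite setT mu).

(** The measure [mu] again; the argument is there so that the proof of
    sigma-finiteness can be retrieved from the term by instance resolution. *)
Definition with_sigma_finite of sigma_finite setT mu : set T -> \bar R := mu.

HB.instance Definition _ := Measure.copy (with_sigma_finite sf) mu.
HB.instance Definition _ :=
  Measure_isSigmaFinite.Build _ _ _ (with_sigma_finite sf) sf.

End SigmaFinite.

Lemma sigma_finite_product d1 d2 (T1 : measurableType d1) (T2 : measurableType d2)
    (R : realType) (m1 : {sigma_finite_measure set T1 -> \bar R})
    (m2 : {sigma_finite_measure set T2 -> \bar R}) :
  sigma_finite setT (m1 \x m2)%E.
Proof.
have /sigma_finiteP[F [TF ndF Foo]] := sigma_finiteT m1.
have /sigma_finiteP[G [TG ndG Goo]] := sigma_finiteT m2.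
exists (fun n => F n `*` G n) => [|k].
  apply/seteqP; split => // -[x y] _.
  have [/= [i _ Fx] [j _ Gy]] : (\bigcup_n F n) x /\ (\bigcup_n G n) y.
    by rewrite -TF -TG.
  exists (maxn i j) => //; split => /=.
    by move: x Fx; exact/subsetPset/ndF/leq_maxl.
  by move: y Gy; exact/subsetPset/ndG/leq_maxr.
have [[mF Fk] [mG Gk]] := (Foo k, Goo k).
split; first exact: measurableX.
by rewrite product_measure1E// lte_mul_pinfty// ge0_fin_numE.
Qed.

Section HaarPower.
Context {R : realType} (K : local_field R).
Hypothesis sf : sigma_finite setT (@haar R K).
Local Open Scope ereal_scope.
Notation T := (lf_space K).

Lemma measurable_tuple_cons n :
  measurable_fun setT (fun p : T * n.-tuple T => [tuple of p.1 :: p.2]).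
Proof. exact: measurable_cons. Qed.

(** [haar_power] is a bare set function; it is the iterated pushforward of product
    measures under [x, t |-> x :: t], and sigma-finiteness is what makes the
    next product a measure. *)
Lemma haar_power_measure n :
  exists m : {sigma_finite_measure set (n.-tuple T) -> \bar R},
    (m : set _ -> \bar R) = @haar_power R K n.
Proof.
elim: n => [|n [m mE]].
  by exists (dirac ([tuple] : 0.-tuple T)).
pose h : {sigma_finite_measure set T -> \bar R} := with_sigma_finite sf.
pose f (p : T * n.-tuple T) : n.+1.-tuple T := [tuple of p.1 :: p.2].
have mf : measurable_fun setT f by exact: measurable_tuple_cons.
pose p' : {measure set (n.+1.-tuple T) -> \bar R} := pushforward (h \x m) f.
pose p := p' mf.
have sfp : sigma_finite setT p.
  pose g (t : n.+1.-tuple T) := (thead t, [tuple of behead t]).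
  have mg : measurable_fun setT g.
    apply/measurable_fun_pair => /=; first exact: measurable_tnth.
    exact: measurable_behead.
  have [F FT Foo] := sigma_finite_product h m.
  exists (fun k => g @^-1` F k).
    by rewrite -preimage_bigcup -FT preimage_setT.
  move=> k; have [mF Fk] := Foo k; split.
    by rewrite -[X in measurable X]setTI; exact: mg.
  rewrite [p _](_ : _ = (h \x m) (F k))//; congr (_ \x _).
  apply/seteqP; split => -[x t]; rewrite /preimage/= /g theadE.
    by rewrite (_ : [tuple of _] = t)//; exact: val_inj.
  by rewrite (_ : [tuple of _] = t)//; exact: val_inj.
exists (with_sigma_finite sfp).
transitivity (fun A => (h \x (m : set _ -> \bar R)) (f @^-1` A)); first by [].
by rewrite mE.
Qed.

(** Tonelli, one coordinate at a time.  The three weights are products over the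
    coordinates, so this computes their total mass. *)
Lemma integral_haar_power_prod n (v : T -> R) (I : R) :
  measurable_fun setT v -> (forall x, 0 <= v x)%R ->
  \int[@haar R K]_x (v x)%:E = I%:E ->
  measurable_fun setT (fun x : n.-tuple T => \prod_(i < n) v (tnth x i))%R /\
  \int[@haar_power R K n]_x (\prod_(i < n) v (tnth x i))%:E = (I ^+ n)%:E.
Proof.
move=> mv v0 vI; have mprod m : measurable_fun setT
    (fun x : m.-tuple T => \prod_(i < m) v (tnth x i))%R.
  by apply: measurable_prod => i _; apply: measurableT_comp => //; exact: measurable_tnth.
split; first exact: mprod.
elim: n => [|n IH].
  rewrite /haar_power (integral_dirac _ _)//; last first.
    apply/measurable_EFinP. exact: mprod.
  by rewrite big_ord0 mule1 diracE in_setT expr0.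
have [m mE] := haar_power_measure n.
pose h : {sigma_finite_measure set T -> \bar R} := with_sigma_finite sf.
transitivity (\int[pushforward (h \x m)
    (fun p : T * n.-tuple T => [tuple of p.1 :: p.2] : n.+1.-tuple T)]_x
      (\prod_(i < n.+1) v (tnth x i))%:E).
  by rewrite mE.
rewrite ge0_integral_pushforward//; last 3 first.
- exact: measurable_tuple_cons.
- by apply/measurable_EFinP; exact: mprod.
- by move=> x _; rewrite lee_fin prodr_ge0.
rewrite preimage_setT fubini_tonelli1//=; last 2 first.
- apply/measurable_EFinP; apply: (measurableT_comp (mprod n.+1)).
  exact: measurable_tuple_cons.
- by move=> x; rewrite lee_fin prodr_ge0.
have prodE (x : T) (t : n.-tuple T) :
  (\prod_(i < n.+1) v (tnth [tuple of x :: t] i))%:E =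
    (v x)%:E * (\prod_(i < n) v (tnth t i))%:E.
  rewrite -EFinM big_ord_recl/=; congr (_ * _)%:E%R.
  by apply: eq_bigr => i _; rewrite tnthS.
rewrite /fubini_F; under eq_integral => x _.
  under eq_integral do rewrite /= prodE.
  rewrite ge0_integralZl//; last 3 first.
  - by apply/measurable_EFinP; exact: mprod.
  - by move=> t _; rewrite lee_fin prodr_ge0.
  - by rewrite lee_fin.
  have -> : \int[m]_(t in setT) (\prod_(i < n) v (tnth t i))%:E = (I ^+ n)%:E.
    by rewrite mE.
  rewrite muleC.
over.
rewrite ge0_integralZl ?vI ?exprS 1?mulrC//; last 3 first.
- exact/measurable_EFinP.
- by move=> t _; rewrite lee_fin.
- by rewrite lee_fin exprn_ge0// -lee_fin -vI integral_ge0// => x _; rewrite lee_fin.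
Qed.

End HaarPower.

(** * Complex-valued integrals *)

Section Modulus.
Context {R : realType}.
Implicit Types z : R[i].
Local Notation Re := (@complex.Re R).
Local Notation Im := (@complex.Im R).

Lemma normr_cmod z : `|z| = (cmod z)%:C%C.
Proof. by []. Qed.

Lemma cmod_ge0 z : 0 <= cmod z.
Proof. by case: z => a b; rewrite /cmod sqrtr_ge0. Qed.

Lemma cmodM z1 z2 : cmod (z1 * z2) = cmod z1 * cmod z2.
Proof. exact: ComplexField.Normc.normcM. Qed.

Lemma cmodD z1 z2 : cmod (z1 + z2) <= cmod z1 + cmod z2.
Proof. exact: (@le_normcD R z1 z2). Qed.

Lemma cmod0 : cmod (0 : R[i]) = 0.
Proof. exact: ComplexField.Normc.normc0. Qed.

Lemma cmodN z : cmod (- z) = cmod z.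
Proof. exact: (@normcN R z). Qed.

Lemma cmod_real (a : R) : cmod a%:C%C = `|a|.
Proof. by rewrite /cmod /= expr0n/= addr0 sqrtr_sqr. Qed.

Lemma cmod_eq0 z : (cmod z == 0) = (z == 0).
Proof.
apply/eqP/eqP => [|->]; last exact: cmod0.
exact: ComplexField.Normc.eq0_normc.
Qed.

Lemma cmod_sum (I : Type) (s : seq I) (F : I -> R[i]) :
  cmod (\sum_(i <- s) F i) <= \sum_(i <- s) cmod (F i).
Proof.
elim/big_ind2 : _ => //; first by rewrite cmod0.
by move=> a b z1 z2 h1 h2; rewrite (le_trans (cmodD _ _))// lerD.
Qed.

Lemma cmod_sqr z : cmod z ^+ 2 = Re z ^+ 2 + Im z ^+ 2.
Proof. by case: z => a b; rewrite /cmod /= sqr_sqrtr// addr_ge0// sqr_ge0. Qed.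

(** Cauchy-Schwarz in the plane, by Lagrange's identity. *)
Lemma re_im_le_cmod (a b : R) z : a * Re z + b * Im z <= cmod (a +i* b)%C * cmod z.
Proof.
case: (leP (a * Re z + b * Im z) 0) => [/le_trans|ab0].
  by apply; rewrite mulr_ge0// cmod_ge0.
rewrite -(@ler_pXn2r _ 2)// ?nnegrE ?mulr_ge0 ?cmod_ge0 ?(ltW ab0)//.
rewrite exprMn !cmod_sqr/= -subr_ge0.
have -> : (a ^+ 2 + b ^+ 2) * (Re z ^+ 2 + Im z ^+ 2) - (a * Re z + b * Im z) ^+ 2 =
    (a * Im z - b * Re z) ^+ 2 by ring.
exact: sqr_ge0.
Qed.

Lemma normr_Re_le z : `|Re z| <= cmod z.
Proof.
rewrite -(@ler_pXn2r _ 2)// ?nnegrE ?cmod_ge0//.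
by rewrite cmod_sqr real_normK ?num_real// lerDl sqr_ge0.
Qed.

Lemma normr_Im_le z : `|Im z| <= cmod z.
Proof.
rewrite -(@ler_pXn2r _ 2)// ?nnegrE ?cmod_ge0//.
by rewrite cmod_sqr real_normK ?num_real// lerDr sqr_ge0.
Qed.

Lemma cmod_le_re_im z : cmod z <= `|Re z| + `|Im z|.
Proof.
rewrite -(@ler_pXn2r _ 2)// ?nnegrE ?cmod_ge0 ?addr_ge0//.
rewrite cmod_sqr sqrrD !real_normK ?num_real// addrAC lerDl.
by rewrite mulrn_wge0// mulr_ge0.
Qed.

End Modulus.

Section ComplexIntegral.
Context d (T : measurableType d) (R : realType).
Implicit Types (D A : set T) (f g : T -> R[i]).
Local Notation Re := (@complex.Re R).
Local Notation Im := (@complex.Im R).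

Definition cmeasurable D f :=
  measurable_fun D (fun x => Re (f x)) /\ measurable_fun D (fun x => Im (f x)).

Lemma cmeasurable_cst D c : cmeasurable D (fun=> c).
Proof. by split; exact: measurable_cst. Qed.

Lemma cmeasurableS D f : cmeasurable setT f -> cmeasurable D f.
Proof. by move=> [h1 h2]; split; exact: measurable_funTS. Qed.

Lemma cmeasurableD D f g : cmeasurable D f -> cmeasurable D g ->
  cmeasurable D (fun x => f x + g x).
Proof.
move=> [f1 f2] [g1 g2]; split.
  rewrite (_ : (fun x => Re _) = fun x => Re (f x) + Re (g x)).
    exact: measurable_funD.
  by apply/funext => x; case: (f x) (g x) => [? ?] [].
rewrite (_ : (fun x => Im _) = fun x => Im (f x) + Im (g x)).
  exact: measurable_funD.
by apply/funext => x; case: (f x) (g x) => [? ?] [].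
Qed.

Lemma cmeasurableM D f g : cmeasurable D f -> cmeasurable D g ->
  cmeasurable D (fun x => f x * g x).
Proof.
move=> [f1 f2] [g1 g2]; split.
  rewrite (_ : (fun x => Re _) = fun x => Re (f x) * Re (g x) - Im (f x) * Im (g x)).
    by apply: measurable_funB; apply: measurable_funM.
  by apply/funext => x; case: (f x) (g x) => [? ?] [].
rewrite (_ : (fun x => Im _) = fun x => Re (f x) * Im (g x) + Im (f x) * Re (g x)).
  by apply: measurable_funD; apply: measurable_funM.
by apply/funext => x; case: (f x) (g x) => [? ?] [].
Qed.

Lemma cmeasurable_sum D (I : Type) (s : seq I) (F : I -> T -> R[i]) :
  (forall i, cmeasurable D (F i)) -> cmeasurable D (fun x => \sum_(i <- s) F i x).
Proof.
move=> mF; elim: s => [|i s IH].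
  by under eq_fun do rewrite big_nil; exact: cmeasurable_cst.
by under eq_fun do rewrite big_cons; exact: cmeasurableD.
Qed.

Lemma cmeasurable_prod D (I : Type) (s : seq I) (F : I -> T -> R[i]) :
  (forall i, cmeasurable D (F i)) -> cmeasurable D (fun x => \prod_(i <- s) F i x).
Proof.
move=> mF; elim: s => [|i s IH].
  by under eq_fun do rewrite big_nil; exact: cmeasurable_cst.
by under eq_fun do rewrite big_cons; exact: cmeasurableM.
Qed.

Lemma cmeasurable_indic D A : measurable A ->
  cmeasurable D (fun x => (\1_A x : R)%:C%C).
Proof. by move=> mA; split; [exact: measurable_indic|exact: measurable_cst]. Qed.

Lemma measurable_cmodX D f n : cmeasurable D f ->
  measurable_fun D (fun x => cmod (f x) ^+ (2 * n)).
Proof.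
move=> [f1 f2].
rewrite (_ : (fun _ => _) = fun x => (Re (f x) ^+ 2 + Im (f x) ^+ 2) ^+ n); last first.
  by apply/funext => x; rewrite exprM cmod_sqr.
by apply: measurable_funX; apply: measurable_funD; exact: measurable_funX.
Qed.

Variable mu : {measure set T -> \bar R}.

Definition cintegrable D f :=
  mu.-integrable D (EFin \o (fun x => Re (f x))) /\
  mu.-integrable D (EFin \o (fun x => Im (f x))).

Lemma cintegrable0 D : cintegrable D (fun=> 0).
Proof. by split; exact: integrable0. Qed.

Lemma cintegrable_bounded D f c : measurable D -> (mu D < +oo)%E ->
  cmeasurable D f -> (forall x, D x -> cmod (f x) <= c) -> cintegrable D f.
Proof.
move=> mD Doo [f1 f2] fc.
split; apply: measurable_bounded_integrable => //;
  exists c; split; rewrite ?num_real// => M cM x /fc h /=;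
  rewrite (le_trans _ (ltW cM))// (le_trans _ h)//.
  exact: normr_Re_le.
exact: normr_Im_le.
Qed.

Lemma cintegrableD D f g : measurable D -> cintegrable D f -> cintegrable D g ->
  cintegrable D (fun x => f x + g x).
Proof.
move=> mD [f1 f2] [g1 g2]; split.
  apply: eq_integrable (integrableD mD f1 g1) => // x _.
  by rewrite /= -EFinD; case: (f x) (g x) => [? ?] [].
apply: eq_integrable (integrableD mD f2 g2) => // x _.
by rewrite /= -EFinD; case: (f x) (g x) => [? ?] [].
Qed.

Lemma cintegrable_sum D (I : Type) (s : seq I) (F : I -> T -> R[i]) :
  measurable D -> (forall i, cintegrable D (F i)) ->
  cintegrable D (fun x => \sum_(i <- s) F i x).
Proof.
move=> mD mF; elim: s => [|i s IH].
  by under eq_fun do rewrite big_nil; exact: cintegrable0.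
by under eq_fun do rewrite big_cons; exact: cintegrableD.
Qed.

Lemma eq_Cintegral D f g : (forall x, D x -> f x = g x) ->
  Cintegral mu D f = Cintegral mu D g.
Proof.
by move=> fg; congr (_ +i* _)%C; apply: eq_Rintegral => x /set_mem /fg ->.
Qed.

Lemma Cintegral0 D : Cintegral mu D (fun=> 0) = 0.
Proof. by rewrite /Cintegral /= /Rintegral integral0. Qed.

Lemma CintegralD D f g : measurable D -> cintegrable D f -> cintegrable D g ->
  Cintegral mu D (fun x => f x + g x) = Cintegral mu D f + Cintegral mu D g.
Proof.
move=> mD [f1 f2] [g1 g2]; rewrite /Cintegral; apply/eqP; rewrite eq_complex/=.
rewrite -!RintegralD//; apply/andP; split; apply/eqP/eq_Rintegral => x _;
  by case: (f x) (g x) => [? ?] [].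
Qed.

Lemma Cintegral_sum D (I : Type) (s : seq I) (F : I -> T -> R[i]) :
  measurable D -> (forall i, cintegrable D (F i)) ->
  Cintegral mu D (fun x => \sum_(i <- s) F i x) = \sum_(i <- s) Cintegral mu D (F i).
Proof.
move=> mD iF; elim: s => [|i s IH].
  rewrite big_nil -[RHS](Cintegral0 D).
  by apply: eq_Cintegral => x _; rewrite big_nil.
rewrite big_cons -IH -CintegralD//; last exact: cintegrable_sum.
by congr Cintegral; apply/funext => x; rewrite big_cons.
Qed.

Lemma cintegrableZ D c f : measurable D -> cintegrable D f ->
  cintegrable D (fun x => c * f x).
Proof.
move=> mD [f1 f2]; case: c => a b; split.
  apply: eq_integrable (integrableB mD (integrableZl mD a f1) (integrableZl mD b f2)) => // x _.
  by rewrite /= -!EFinM -EFinB; case: (f x) => [? ?].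
apply: eq_integrable (integrableD mD (integrableZl mD a f2) (integrableZl mD b f1)) => // x _.
by rewrite /= -!EFinM -EFinD; case: (f x) => [? ?].
Qed.

Lemma CintegralZ D c f : measurable D -> cintegrable D f ->
  Cintegral mu D (fun x => c * f x) = c * Cintegral mu D f.
Proof.
move=> mD [f1 f2]; case: c => a b.
have Zi k (g : T -> R) : mu.-integrable D (EFin \o g) -> mu.-integrable D (EFin \o (fun x => k * g x)).
  by move=> ig; apply: eq_integrable (integrableZl mD k ig).
rewrite /Cintegral; apply/eqP; rewrite eq_complex/= -!RintegralZl//.
rewrite -RintegralB; [|exact: mD|exact: Zi|exact: Zi].
rewrite -RintegralD; [|exact: mD|exact: Zi|exact: Zi].
apply/andP; split; apply/eqP/eq_Rintegral => x _; by case: (f x).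
Qed.

Lemma Cintegral_cst D c : measurable D ->
  Cintegral mu D (fun=> c) = c * (fine (mu D))%:C%C.
Proof.
move=> mD; rewrite /Cintegral !Rintegral_cst//; case: c => a b /=.
by apply/eqP; rewrite eq_complex/= !mulr0 subr0 add0r !eqxx.
Qed.

(** Pairing the value [z] of the integral with the integrand, as vectors of the
    plane, bounds [|z| ^ 2] by [|z|] times the expected bound.  Bounding the real
    and imaginary parts separately would lose a factor [sqrt 2], which the upper
    bound on the square function cannot afford. *)
Lemma Cintegral_bound D f c : measurable D -> (mu D < +oo)%E ->
  cmeasurable D f -> (forall x, D x -> cmod (f x) <= c) -> 0 <= c ->
  cmod (Cintegral mu D f) <= c * fine (mu D).
Proof.
move=> mD Doo mf fc c0.
have [f1 f2] := cintegrable_bounded mD Doo mf fc.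
set z := Cintegral mu D f.
have zz : cmod z ^+ 2 <= cmod z * (c * fine (mu D)).
  have Zi k (g : T -> R) : mu.-integrable D (EFin \o g) -> mu.-integrable D (EFin \o (fun x => k * g x)).
    by move=> ig; apply: eq_integrable (integrableZl mD k ig).
  have -> : cmod z ^+ 2 =
      \int[mu]_(x in D) (Re z * Re (f x) + Im z * Im (f x)).
    rewrite RintegralD; [|exact: mD|exact: Zi|exact: Zi].
    by rewrite !RintegralZl// cmod_sqr !expr2.
  rewrite mulrA -Rintegral_cst//; apply: le_Rintegral => //.
  - by apply: eq_integrable (integrableD mD (Zi (Re z) _ f1) (Zi (Im z) _ f2)).
  - apply: measurable_bounded_integrable => //.
    exists (cmod z * c); split; rewrite ?num_real// => M cM x /= _.
    by rewrite ger0_norm ?mulr_ge0 ?cmod_ge0// (ltW cM).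
  move=> x Dx; apply: (le_trans (re_im_le_cmod _ _ _)).
  rewrite (_ : (Re z +i* Im z)%C = z); last by case: (z).
  by rewrite ler_wpM2l ?cmod_ge0// fc.
have [z0|z0] := eqVneq (cmod z) 0; first by rewrite z0 mulr_ge0// fine_ge0.
by rewrite -(@ler_pM2l _ (cmod z))// lt_neqAle eq_sym z0 cmod_ge0.
Qed.

Lemma Cintegral_indic D A f : A `<=` D ->
  Cintegral mu D (fun x => (\1_A x : R)%:C%C * f x) = Cintegral mu A f.
Proof.
move=> AD; have DA : A = D `&` A by rewrite setIidr.
rewrite /Cintegral [in RHS]DA !Rintegral_mkcondr.
congr (_ +i* _)%C; apply: eq_Rintegral => x _; rewrite patchE indicE;
  case: ifPn => _; case: (f x) => a b /=; by rewrite ?mul1r ?mul0r ?subr0 ?addr0.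
Qed.

Lemma Cintegral_indic0 D A f : A `&` D = set0 ->
  Cintegral mu D (fun x => (\1_A x : R)%:C%C * f x) = 0.
Proof.
move=> AD; rewrite -[RHS](Cintegral0 D); apply: eq_Cintegral => x Dx.
by rewrite indicE memNset ?mul0r// => Ax; rewrite -[False]/(set0 x) -AD.
Qed.

End ComplexIntegral.

(** * Estimates for the averaging argument *)

Section RealLemmas.
Context {R : realType}.

Lemma moment_cmod M (zeta : R[i]) N n (z : nat -> R[i]) :
  M.-primitive_root zeta -> (n < M)%N -> (forall j, (j < N)%N -> cmod (z j) = 1) ->
  (M ^ N * (n`! * N ^_ n))%:R <=
    \sum_(eps <- phase_vectors M zeta N) cmod (\sum_(j < N) eps`_j * z j) ^+ (2 * n).
Proof.
move=> zP nM z1; rewrite -lecR.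
have z1' j : (j < N)%N -> `|z j| = 1 by move=> jN; rewrite normr_cmod z1.
apply: le_trans (le_trans (moment_phase_vectors zP nM z1') _).
  by rewrite rmorph_nat.
by rewrite rmorph_sum/= ler_sum// => eps _; rewrite normr_cmod rmorphXn.
Qed.

(** The [m]-th power is Lipschitz on the segment from 0 to [L], up to which [b] may
    be truncated. *)
Lemma pow_perturb (a b s L : R) m : 0 <= a <= L -> 0 <= b -> 0 <= s -> 1 <= L ->
  a <= b + s -> a ^+ m <= b ^+ m + m%:R * L ^+ m * s.
Proof.
move=> /andP[a0 aL] b0 s0 L1 ab; have L0 : 0 <= L by rewrite (le_trans _ L1).
elim: m => [|m IH]; first by rewrite !expr0 !mul0r addr0.
have [ba|ba] := leP a b.
  apply: ler_wpDr; last by rewrite lerXn2r.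
  by rewrite !mulr_ge0// exprn_ge0.
have bL : b ^+ m <= L ^+ m by rewrite lerXn2r ?nnegrE// (le_trans (ltW ba)).
have mLs : 0 <= m%:R * L ^+ m * s by rewrite !mulr_ge0// exprn_ge0.
have Lm : L ^+ m <= L ^+ m.+1 by rewrite exprS ler_peMl// exprn_ge0.
have bm0 : 0 <= b ^+ m by rewrite exprn_ge0.
rewrite !exprS.
apply: (@le_trans _ _ (a * (b ^+ m + m%:R * L ^+ m * s))); first by rewrite ler_wpM2l.
have h1 : (a - b) * b ^+ m <= s * L ^+ m.+1.
  by apply: ler_pM => //; [lra|lra|exact: le_trans Lm].
have h2 : a * (m%:R * L ^+ m * s) <= L * (m%:R * L ^+ m * s) by rewrite ler_wpM2r.
rewrite -(natr1 m); rewrite exprS in h1.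
set u := m%:R in h2 h1 *; set p := L ^+ m in h2 h1 *; set q := b ^+ m in h2 h1 *.
have -> : a * (q + u * p * s) = b * q + (a - b) * q + a * (u * p * s) by ring.
have -> : (u + 1) * (L * p) * s = L * (u * p * s) + s * (L * p) by ring.
lra.
Qed.

Lemma ffact_ratio N n : (0 < N)%N ->
  1 - (n ^ 2)%:R / N%:R <= (N ^_ n)%:R / N%:R ^+ n :> R.
Proof.
move=> N0; have N0' : 0 < N%:R :> R by rewrite ltr0n.
elim: n => [|n IH]; first by rewrite ffactn0 expr0 divr1 mul0r subr0.
have le1 : (N ^_ n)%:R / N%:R ^+ n <= 1 :> R.
  rewrite ler_pdivrMr ?exprn_gt0// mul1r -natrX ler_nat.
  by elim: n {IH} => // n IHn; rewrite ffactnSr expnSr leq_mul// leq_subr.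
have ge0 : 0 <= (N ^_ n)%:R / N%:R ^+ n :> R by rewrite divr_ge0// exprn_ge0.
have [nN|Nn] := leqP n N; last first.
  rewrite ffact_small ?mul0r; last exact: leq_trans Nn _.
  rewrite subr_le0 ler_pdivlMr// mul1r ler_nat.
  by rewrite (leq_trans (ltnW Nn))// (leq_trans (leqnSn _))// -mulnn leq_pmulr.
have -> : (N ^_ n.+1)%:R / N%:R ^+ n.+1 =
    (N ^_ n)%:R / N%:R ^+ n * (1 - n%:R / N%:R) :> R.
  rewrite ffactnSr natrM natrB// exprSr; field.
  by rewrite expf_neq0 ?gt_eqF//= gt_eqF.
set x : R := (N ^_ n)%:R / N%:R ^+ n in IH le1 ge0 *.
have q0 : 0 <= n%:R / N%:R :> R by rewrite divr_ge0.
have : x * (n%:R / N%:R) <= n%:R / N%:R by rewrite ler_piMl.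
have : (n.+1 ^ 2)%:R / N%:R = (n ^ 2)%:R / N%:R + 2 * (n%:R / N%:R) + N%:R^-1 :> R.
  by rewrite -!mulnn mulSn mulnS !natrD natrM -natr1 ; field; rewrite gt_eqF.
have : 0 <= N%:R^-1 :> R by rewrite invr_ge0.
by rewrite mulrBr mulr1; lra.
Qed.

Lemma common_radius (I : finType) (P : I -> R -> Prop) :
  (forall i, exists2 r, 0 < r & forall s, s <= r -> P i s) ->
  exists2 r, 0 < r & forall i, P i r.
Proof.
move=> ex; suff [r r0 rP] : exists2 r, 0 < r &
    forall i, i \in enum I -> forall s, s <= r -> P i s.
  by exists r => // i; apply: rP; rewrite ?mem_enum.
elim: (enum I) => [|i s [r r0 rP]]; first by exists 1.
have [q q0 qP] := ex i.
exists (Num.min q r); first by rewrite lt_min q0.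
move=> j; rewrite inE => /orP[/eqP ->|js] t; rewrite le_min => /andP[tq tr].
  exact: qP.
exact: rP.
Qed.

End RealLemmas.

(** If every [G i] had an integral smaller than [k * b], so would their mean,
    against the pointwise lower bound for it. *)
Lemma exists_ge_average d (T : measurableType d) (R : realType)
    (mu : {measure set T -> \bar R}) (I : eqType) (s : seq I) (G : I -> T -> R)
    (g : T -> R) (k b : R) :
  s != [::] -> (forall i, measurable_fun setT (G i)) -> (forall i x, 0 <= G i x) ->
  measurable_fun setT g -> (forall x, 0 <= g x) -> 0 <= k ->
  (\int[mu]_x (g x)%:E = b%:E)%E ->
  (forall x, (size s)%:R * k * g x <= \sum_(i <- s) G i x) ->
  exists2 i, i \in s & ((k * b)%:E <= \int[mu]_x (G i x)%:E)%E.
Proof.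
move=> s0 mG G0 mg g0 k0 gb le_sum.
apply/not_exists2P => /= hlt.
have {}hlt i : i \in s -> (\int[mu]_x (G i x)%:E < (k * b)%:E)%E.
  by move=> is_; case: (hlt i) => // /negP; rewrite -ltNge.
have sumE : (\int[mu]_x (\sum_(i <- s) G i x)%:E = \sum_(i <- s) \int[mu]_x (G i x)%:E)%E.
  under eq_integral do rewrite -sumEFin.
  rewrite ge0_integral_sum// => i; first exact/measurable_EFinP.
  by move=> x _; rewrite lee_fin.
have : (((size s)%:R * k * b)%:E <= \sum_(i <- s) \int[mu]_x (G i x)%:E)%E.
  rewrite -sumE EFinM -gb -ge0_integralZl//; last 3 first.
  - exact/measurable_EFinP.
  - by move=> x _; rewrite lee_fin.
  - by rewrite lee_fin mulr_ge0.
  by apply: ge0_le_integral_nonmeasurable => x; rewrite -EFinM lee_fin ?mulr_ge0.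
apply/negP; rewrite -ltNge.
have fin i : i \in s -> (\int[mu]_x (G i x)%:E)%E = (fine (\int[mu]_x (G i x)%:E))%:E.
  move=> is_; rewrite fineK// ge0_fin_numE ?(lt_trans (hlt _ is_)) ?ltry//.
  by apply: integral_ge0 => x _; rewrite lee_fin.
rewrite (eq_big_seq _ fin) sumEFin lte_fin.
have {fin}hlt i : i \in s -> fine (\int[mu]_x (G i x)%:E)%E < k * b.
  by move=> is_; rewrite -lte_fin -fin// hlt.
rewrite -mulrA.
case: s s0 hlt {sumE le_sum} => // i s _ hlt.
elim: s i hlt => [|j s IH] i hlt.
  by rewrite big_seq1 mul1r hlt// mem_seq1.
rewrite big_cons -natr1 mulrDl mul1r addrC ltrD ?hlt ?mem_head//.
by apply: IH => u us; apply: hlt; rewrite inE us orbT.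
Qed.

(** * The properties of a local field behind the lower bound *)

Lemma abs_poly_continuous (R : realType) (K : fieldType) (abs : K -> R)
    (abs0 : abs 0 = 0) (abs_ge0 : forall x, 0 <= abs x)
    (absD : forall x y, abs (x + y) <= abs x + abs y)
    (absM : forall x y, abs (x * y) = abs x * abs y) (p : {poly K}) (xi0 : K) t :
  0 < t ->
  exists2 r, 0 < r & forall xi, abs (xi - xi0) <= r -> abs (p.[xi] - p.[xi0]) <= t.
Proof.
move: t; elim/poly_ind: p => [|q c IH] t t0.
  by exists 1 => // xi _; rewrite !horner0 subrr abs0 ltW.
pose L := abs xi0 + 1; pose Q := abs q.[xi0] + 1.
have L0 : 0 < L by rewrite ltr_wpDl// abs_ge0.
have Q0 : 0 < Q by rewrite ltr_wpDl// abs_ge0.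
have [|r r0 rP] := IH (t / 2 / L); first by rewrite !divr_gt0.
exists (Num.min 1 (Num.min r (t / 2 / Q))).
  by rewrite !lt_min r0 ltr01 !divr_gt0.
move=> xi; rewrite !le_min => /and3P[d1 dr dt]; rewrite !hornerMXaddC.
have -> : q.[xi] * xi + c - (q.[xi0] * xi0 + c) =
  (q.[xi] - q.[xi0]) * xi + q.[xi0] * (xi - xi0) by ring.
apply: (le_trans (absD _ _)); rewrite !absM.
have -> : t = t / 2 / L * L + Q * (t / 2 / Q).
  by field; rewrite !gt_eqF.
apply: lerD; apply: ler_pM => //; rewrite ?abs_ge0 ?rP//.
  rewrite -[xi](subrK xi0) (le_trans (absD _ _))// addrC /L.
  by rewrite lerD.
by rewrite /Q lerDl.
Qed.

(** What the construction of test functions requires of the partition at a given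
    scale: in every piece, room for a function arbitrarily close to a point mass. *)
Definition concentrable_partition (R : realType) (K : local_field R) (abs : K -> R)
    (P : set (set K)) : Prop :=
  [/\ finite_set P,
      forall I J, P I -> P J -> I `&` J !=set0 -> I = J &
      forall J, P J -> [/\ measurable (J : set (lf_space K)),
        J `<=` fd_cell (data_of K) &
        exists xi0, forall t, 0 < t -> exists A : set K,
          [/\ measurable (A : set (lf_space K)), A `<=` J,
              forall xi, A xi -> abs (xi - xi0) <= t &
              (0 < haar K A < +oo)%E]]].

(** The absolute value [abs] expresses continuity and boundedness.  On the complex
    field it is the Euclidean modulus: unlike the maximum of the real and
    imaginary parts it is multiplicative, and it defines the same topology.
    The weight is asked to be a product over the coordinates of an integrable
    function of positive integral. *)
Record tame_field (R : realType) (w : R -> R) (K : local_field R) (abs : K -> R) :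
    Prop := TameField {
  tame_abs0 : abs 0 = 0;
  tame_abs_ge0 : forall x, 0 <= abs x;
  tame_absD : forall x y, abs (x + y) <= abs x + abs y;
  tame_absM : forall x y, abs (x * y) = abs x * abs y;
  tame_ball_measurable : forall r,
    measurable ([set x | abs x <= r] : set (lf_space K));
  tame_ball_finite : forall r, (haar K [set x | (abs x <= r)%R] < +oo)%E;
  tame_charD : forall x y,
    fd_char (data_of K) (x + y) = fd_char (data_of K) x * fd_char (data_of K) y;
  tame_char_cmod : forall x, cmod (fd_char (data_of K) x) = 1;
  tame_char_near1 : forall eta, 0 < eta ->
    exists2 t, 0 < t & forall x, abs x <= t -> cmod (fd_char (data_of K) x - 1) <= eta;
  tame_char_measurable : forall p : {poly K},
    cmeasurable setT (fun xi : lf_space K => fd_char (data_of K) p.[xi]);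
  tame_cell_compact : compact (fd_cell (data_of K) : set (lf_top K));
  tame_cell_closed : closed (fd_cell (data_of K) : set (lf_top K));
  tame_cell_measurable : measurable (fd_cell (data_of K) : set (lf_space K));
  tame_cell_finite : (haar K (fd_cell (data_of K)) < +oo)%E;
  tame_partition : forall N0 : nat, exists2 delta, fd_scales (data_of K) delta &
    concentrable_partition abs (fd_partition (data_of K) delta) /\
    (N0 <= #|` fset_set (fd_partition (data_of K) delta)|)%N;
  tame_weight : forall (n : nat) delta, fd_scales (data_of K) delta ->
    exists (v : lf_space K -> R) (b : R),
    [/\ measurable_fun setT v, forall x, 0 <= v x, 0 < b,
        (\int[haar K]_x (v x)%:E = b%:E)%E &
        forall x : n.-tuple K,
          dilated_weight w [tuple 0 | i < n] (delta ^- n) x = \prod_(i < n) v (tnth x i)] }.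

Section Tame.
Context {R : realType} {w : R -> R} {K : local_field R} {abs : K -> R}.
Hypothesis tame : tame_field w abs.

Lemma sigma_finite_haar : sigma_finite setT (haar K).
Proof.
exists (fun k : nat => [set x | abs x <= k%:R]); last first.
  by move=> k; split; [exact: (tame_ball_measurable tame)|exact: (tame_ball_finite tame)].
apply/seteqP; split => // x _; exists (Num.truncn (abs x)).+1 => //=.
by rewrite ltW// truncnS_gt// (tame_abs_ge0 tame).
Qed.

Lemma tame_poly_continuous (p : {poly K}) (xi0 : K) t : 0 < t ->
  exists2 r, 0 < r & forall xi, abs (xi - xi0) <= r -> abs (p.[xi] - p.[xi0]) <= t.
Proof.
apply: abs_poly_continuous; [exact: (tame_abs0 tame)|exact: (tame_abs_ge0 tame)|
  exact: (tame_absD tame)|exact: (tame_absM tame)].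
Qed.

Definition phase n (gamma : n.-tuple {poly K}) (xi : K) (x : n.-tuple K) : R[i] :=
  fd_char (data_of K) (\sum_(i < n) (tnth gamma i).[xi] * tnth x i).

(** Continuity of [gamma], uniform for [x] in a box because [x] enters linearly. *)
Lemma phase_near n (gamma : n.-tuple {poly K}) (xi0 : K) (k : R) eta : 0 < eta ->
  exists2 r, 0 < r & forall xi, abs (xi - xi0) <= r ->
    forall x : n.-tuple K, (forall i, abs (tnth x i) <= k) ->
    cmod (phase gamma xi x - phase gamma xi0 x) <= eta.
Proof.
move=> eta0; have [t t0 tP] := tame_char_near1 tame eta0.
pose k' := Num.max k 1; have k'0 : 0 < k' by rewrite lt_max ltr01 orbT.
have [i|r r0 rP] := @common_radius R 'I_n (fun i r => forall xi, abs (xi - xi0) <= r ->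
    abs ((tnth gamma i).[xi] - (tnth gamma i).[xi0]) <= t / n.+1%:R / k').
  have [|r r0 rP] := @tame_poly_continuous (tnth gamma i) xi0 (t / n.+1%:R / k').
    by rewrite !divr_gt0.
  by exists r => // s sr xi xis; apply: rP; exact: le_trans sr.
exists r => // xi xir x xk; rewrite /phase.
set s := \sum_(i < n) _; set s0 := (X in _ - fd_char _ X).
have -> : s = (s - s0) + s0 by rewrite subrK.
rewrite (tame_charD tame) -{2}[fd_char _ s0]mul1r -mulrBl cmodM (tame_char_cmod tame) mulr1.
apply: tP; rewrite /s /s0 -sumrB.
have abs_sum (I : Type) (u : seq I) (F : I -> K) :
    abs (\sum_(i <- u) F i) <= \sum_(i <- u) abs (F i).
  elim/big_ind2 : _ => //; first by rewrite (tame_abs0 tame).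
  by move=> a b z1 z2 h1 h2; rewrite (le_trans (tame_absD tame _ _))// lerD.
apply: (le_trans (abs_sum _ _ _)).
apply: (@le_trans _ _ (\sum_(i < n) t / n.+1%:R)).
  apply: ler_sum => i _; rewrite -mulrBl (tame_absM tame).
  rewrite -[leRHS](divfK (lt0r_neq0 k'0)).
  apply: ler_pM; rewrite ?(tame_abs_ge0 tame)// ?rP//.
  by rewrite le_max xk.
rewrite sumr_const card_ord -[leLHS]mulr_natl mulrA ler_pdivrMr// mulrC ler_pM2l//.
by rewrite ler_nat.
Qed.

Lemma cmeasurable_phase_xi n (gamma : n.-tuple {poly K}) (x : n.-tuple K) D :
  cmeasurable D (fun xi : lf_space K => phase gamma xi x).
Proof.
apply: cmeasurableS.
have := tame_char_measurable tame (\sum_(i < n) tnth gamma i * (tnth x i)%:P).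
congr cmeasurable; apply/funext => xi; rewrite /phase horner_sum.
by congr (fd_char _ _); apply: eq_bigr => i _; rewrite hornerM hornerC.
Qed.

Lemma tame_char0 : fd_char (data_of K) 0 = 1.
Proof.
have c0 : fd_char (data_of K) 0 != 0 by rewrite -cmod_eq0 (tame_char_cmod tame) oner_eq0.
by apply: (mulfI c0); rewrite -(tame_charD tame) addr0 mulr1.
Qed.

(** The phase is a product of characters of the coordinates.  Factoring it avoids
    the measurability of addition on the product of two copies of the field,
    which would require a countable base for the topology. *)
Lemma cmeasurable_phase_x n (gamma : n.-tuple {poly K}) (xi : K) :
  cmeasurable setT (fun x : n.-tuple (lf_space K) => phase gamma xi x).
Proof.
rewrite (_ : (fun x => _) = fun x : n.-tuple (lf_space K) =>
    \prod_(i < n) fd_char (data_of K) ((tnth gamma i).[xi] * tnth x i)); last first.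
  apply/funext => x; rewrite /phase.
  elim/big_ind2 : _ => //; first exact: tame_char0.
  by move=> a a' b b' <- <-; rewrite (tame_charD tame).
apply: cmeasurable_prod => i.
have [h1 h2] := tame_char_measurable tame ((tnth gamma i).[xi] *: 'X).
have E (y : K) : ((tnth gamma i).[xi] *: 'X).[y] = (tnth gamma i).[xi] * y.
  by rewrite hornerZ hornerX.
split.
  have := measurableT_comp h1 (@measurable_tnth _ (lf_space K) n i).
  by congr measurable_fun; apply/funext => x /=; rewrite E.
have := measurableT_comp h2 (@measurable_tnth _ (lf_space K) n i).
by congr measurable_fun; apply/funext => x /=; rewrite E.
Qed.

Definition box n (k : nat) : set (n.-tuple (lf_space K)) :=
  [set x | forall i, abs (tnth x i) <= k%:R].

Lemma measurable_box n k : measurable (@box n k).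
Proof.
rewrite (_ : box k = \bigcap_(i in [set: 'I_n])
    ((@tnth n (lf_space K))^~ i @^-1` [set x | abs x <= k%:R])); last first.
  by apply/seteqP; split => x /= h; [move=> i _|move=> i]; exact: h.
apply: fin_bigcap_measurable => // i _.
rewrite -[X in measurable X]setTI; apply: measurable_tnth => //.
exact: (tame_ball_measurable tame).
Qed.

(** The boxes exhaust the space, so they carry almost all the mass of the weight. *)
Lemma integral_box n (m : {measure set (n.-tuple (lf_space K)) -> \bar R})
    (V : n.-tuple (lf_space K) -> R) (b b' : R) :
  measurable_fun setT V -> (forall x, 0 <= V x) ->
  (\int[m]_x (V x)%:E = b%:E)%E -> b' < b ->
  exists k, (b'%:E <= \int[m]_x (V x * \1_(box k) x)%:E)%E.
Proof.
move=> mV V0 Vb bb.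
have boxT : \bigcup_k (@box n k) = setT.
  apply/seteqP; split => // x _.
  exists (\sum_(i < n) (Num.truncn (abs (tnth x i))).+1)%N => // i.
  apply: (@le_trans _ _ (Num.truncn (abs (tnth x i))).+1%:R).
    by rewrite ltW// truncnS_gt// (tame_abs_ge0 tame).
  by rewrite ler_nat (bigD1 i)//= leq_addr.
have cvg : (\int[m]_(x in box k) (V x)%:E)%E @[k --> \oo] --> b%:E.
  rewrite -Vb -boxT; apply: ge0_nondecreasing_set_cvg_integral.
  - move=> i j ij; apply/subsetPset => x /= h l; apply: (le_trans (h l)).
    by rewrite ler_nat.
  - exact: measurable_box.
  - by move=> k; apply: measurable_funTS; exact/measurable_EFinP.
  - by move=> k x _; rewrite lee_fin.
have [k _ kP] : \forall k \near \oo, (b'%:E < \int[m]_(x in box k) (V x)%:E)%E.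
  apply: (cvg [set y | b'%:E < y]%E); apply: open_nbhs_nbhs; split; first exact: open_ereal_gt_ereal.
  by rewrite /= lte_fin.
exists k; rewrite ltW// (lt_le_trans (kP k _))//=.
rewrite integral_mkcond le_eqVlt; apply/orP; left; apply/eqP.
apply: eq_integral => x _; rewrite patchE indicE; case: ifPn => _.
  by rewrite mulr1.
by rewrite mulr0.
Qed.

End Tame.

(** * Test functions concentrated near finitely many points *)

Section Concentrated.
Context {R : realType} {w : R -> R} {K : local_field R} {abs : K -> R}.
Hypothesis tame : tame_field w abs.
Context {n : nat} (gamma : n.-tuple {poly K}).

Definition mass (A : set (lf_space K)) : R := fine (haar K A).

(** The mean over [A] of the phase: the extension of the normalized indicator of
    [A]. *)
Definition averaged_phase (A : set (lf_space K)) (x : n.-tuple K) : R[i] :=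
  ((mass A)^-1)%:C%C * Cintegral (haar K) A (fun xi => phase gamma xi x).

Lemma mass_gt0 (A : set (lf_space K)) : (0 < haar K A < +oo)%E -> 0 < mass A.
Proof. by move=> A0; exact: fine_gt0. Qed.

Lemma cmod_massV (A : set (lf_space K)) : (0 < haar K A < +oo)%E ->
  cmod ((mass A)^-1)%:C%C = (mass A)^-1.
Proof. by move=> /mass_gt0 A0; rewrite cmod_real ger0_norm// invr_ge0 ltW. Qed.

Lemma averaged_phase_le1 A x : measurable A -> (0 < haar K A < +oo)%E ->
  cmod (averaged_phase A x) <= 1.
Proof.
move=> mA A0; have A1 := mass_gt0 A0.
rewrite /averaged_phase cmodM cmod_massV// mulrC ler_pdivrMr//.
apply: Cintegral_bound => //; first by case/andP: A0.
  exact: (cmeasurable_phase_xi tame).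
by move=> xi _; rewrite (tame_char_cmod tame).
Qed.

Lemma averaged_phase_near A x xi0 t : measurable A -> (0 < haar K A < +oo)%E ->
  (forall xi, A xi -> cmod (phase gamma xi x - phase gamma xi0 x) <= t) -> 0 <= t ->
  cmod (averaged_phase A x - phase gamma xi0 x) <= t.
Proof.
move=> mA A0 near_t t0; have A1 := mass_gt0 A0; have /andP[_ Aoo] := A0.
have m1 := cmeasurable_phase_xi tame gamma x A.
have i1 : cintegrable (haar K) A (fun xi => phase gamma xi x).
  by apply: (cintegrable_bounded (c := 1)) => // xi _; rewrite (tame_char_cmod tame).
pose c := - phase gamma xi0 x.
have i2 : cintegrable (haar K) A (fun=> c).
  by apply: (cintegrable_bounded (c := cmod c)) => //; exact: cmeasurable_cst.
have -> : averaged_phase A x - phase gamma xi0 x =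
    ((mass A)^-1)%:C%C * Cintegral (haar K) A (fun xi => phase gamma xi x - phase gamma xi0 x).
  rewrite CintegralD// Cintegral_cst// mulrDr; congr (_ + _).
  rewrite mulrCA -rmorphM/= mulVf ?mulr1// gt_eqF//.
rewrite cmodM cmod_massV// mulrC ler_pdivrMr//.
by apply: Cintegral_bound => //; apply: cmeasurableD => //; exact: cmeasurable_cst.
Qed.

Context {N : nat} (eps : 'I_N -> R[i]) (A : 'I_N -> set (lf_space K)).
Hypotheses (mA : forall j, measurable (A j))
  (A0 : forall j, (0 < haar K (A j) < +oo)%E).

(** A combination of point masses smeared out over the sets [A j]. *)
Definition concentrated (xi : K) : R[i] :=
  \sum_(j < N) eps j / (mass (A j))%:C%C * (\1_(A j) xi : R)%:C%C.

Lemma extension_concentrated (D : set (lf_space K)) x :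
  measurable D -> (haar K D < +oo)%E ->
  (forall j, A j `<=` D \/ A j `&` D = set0) ->
  extension gamma D concentrated x =
    \sum_(j < N) if `[< A j `<=` D >] then eps j * averaged_phase (A j) x else 0.
Proof.
move=> mD Doo AD; rewrite /extension.
transitivity (Cintegral (haar K) D (fun xi => \sum_(j < N)
    eps j / (mass (A j))%:C%C * ((\1_(A j) xi : R)%:C%C * phase gamma xi x))).
  apply: eq_Cintegral => xi _; rewrite /concentrated mulr_suml.
  by apply: eq_bigr => j _; rewrite mulrA.
have i1 j : cintegrable (haar K) D (fun xi => (\1_(A j) xi : R)%:C%C * phase gamma xi x).
  apply: (cintegrable_bounded (c := 1)) => //.
    apply: cmeasurableM; first exact: cmeasurable_indic.
    exact: (cmeasurable_phase_xi tame).
  move=> xi _; rewrite cmodM (tame_char_cmod tame) mulr1 cmod_real indicE.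
  by case: (_ \in _); rewrite ?normr1 ?normr0.
rewrite Cintegral_sum// => [|j]; last exact: cintegrableZ.
apply: eq_bigr => j _; rewrite CintegralZ//.
case: asboolP => AjD; first by rewrite Cintegral_indic// /averaged_phase -fmorphV mulrA.
by rewrite Cintegral_indic0 ?mulr0//; case: (AD j).
Qed.

(** The support lies in the cell, which is closed and compact. *)
Lemma admissible_concentrated : (forall j, A j `<=` fd_cell (data_of K)) ->
  admissible concentrated.
Proof.
move=> Acell.
have mc D : cmeasurable D (concentrated : lf_space K -> R[i]).
  apply: cmeasurable_sum => j; apply: cmeasurableM; first exact: cmeasurable_cst.
  exact: cmeasurable_indic.
have ic : cintegrable (haar K) (fd_cell (data_of K)) concentrated.
  apply: cintegrable_sum => [|j]; first exact: (tame_cell_measurable tame).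
  apply: cintegrableZ; first exact: (tame_cell_measurable tame).
  apply: (cintegrable_bounded (c := 1)).
  - exact: (tame_cell_measurable tame).
  - exact: (tame_cell_finite tame).
  - exact: cmeasurable_indic.
  move=> xi _; rewrite cmod_real indicE.
  by case: (_ \in _); rewrite ?normr1 ?normr0.
have [m1 m2] := mc setT; have [i1 i2] := ic.
split => //.
apply: (subclosed_compact _ (tame_cell_compact tame)); first exact: closed_closure.
have /closure_id -> := tame_cell_closed tame.
apply: closureS => xi /=; apply: contra_neqP => cellN.
rewrite /concentrated big1// => j _.
by rewrite indicE memNset ?mulr0// => /Acell.
Qed.

End Concentrated.

(** * The lower bound from these properties *)

Section Generic.
Context {R : realType} {w : R -> R} {K : local_field R} {abs : K -> R}.
Hypothesis tame : tame_field w abs.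
Context {n : nat} (n0 : (0 < n)%N) (gamma : n.-tuple {poly K}).

(** The heart of the proof, at a fixed scale: any factor smaller than
    [n! * (N)_n / N ^ n] is attained.  The order of the choices matters: first
    the box, then the phases, which may depend on it, and last the small sets
    on which the test function lives. *)
Lemma exists_test_function delta (N := #|` fset_set (fd_partition (data_of K) delta)|) a :
  fd_scales (data_of K) delta -> (0 < N)%N ->
  concentrable_partition abs (fd_partition (data_of K) delta) ->
  0 <= a < (n`! * N ^_ n)%:R ->
  let V := dilated_weight w [tuple 0 | i < n] (delta ^- n) in
  let moment (g : n.-tuple K -> R) :=
    (\int[@haar_power R K n]_x (g x ^+ (2 * n) * V x)%:E)%E in
  exists f, [/\ admissible f,
    (0 < moment (square_function gamma delta f) < +oo)%E &
    ((a / N%:R ^+ n)%:E * moment (square_function gamma delta f) <=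
      moment (fun x => cmod (extension gamma (fd_cell (data_of K)) f x)))%E].
Proof.
move=> sdelta N0 hP /andP[a0 aA] V moment; have [Pfin Pdisj Ppiece] := hP.
set A0 : R := (n`! * N ^_ n)%:R in aA.
have [v [b [mv v0 b0 vb VE]]] := tame_weight tame n sdelta.
have sf := sigma_finite_haar tame.
have [m mE] := haar_power_measure sf n.
have [mV VI] := integral_haar_power_prod sf n mv v0 vb.
have VE' : V = fun x => \prod_(i < n) v (tnth x i) by apply/funext.
rewrite -VE' in mV.
have {}VI : (\int[m]_x (V x)%:E = (b ^+ n)%:E)%E by rewrite mE VE'.
have V0 x : 0 <= V x by rewrite VE' prodr_ge0.
have momentE g : moment g = (\int[m]_x (g x ^+ (2 * n) * V x)%:E)%E.
  by rewrite /moment -mE.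
clearbody V; clear VE VE' mv v0 vb.
have bn0 : 0 < b ^+ n by rewrite exprn_gt0.
(* Room is left twice between [a] and [A0]: [A0 - q] pays for the error [C * t],
   and [q - a'] for the mass of the weight outside the box. *)
pose q := (a + A0) / 2.
have aq : a < q by rewrite /q; lra.
have qA : q < A0 by rewrite /q; lra.
have q0 : 0 < q by exact: le_lt_trans aq.
pose a' := (a + q) / 2.
have aa' : a < a' by rewrite /a'; lra.
have a'q : a' < q by rewrite /a'; lra.
have b'b : a' * b ^+ n / q < b ^+ n.
  by rewrite ltr_pdivrMr// mulrC ltr_pM2l.
have [k kP] := integral_box tame mV V0 VI b'b.
pose g (x : n.-tuple (lf_space K)) : R := V x * \1_(@box R K abs n k) x.
have g0 x : 0 <= g x by rewrite mulr_ge0.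
have gV x : g x <= V x by rewrite /g ler_piMr// indicE; case: (_ \in _).
have gin x : @box R K abs n k x -> g x = V x.
  by move=> xk; rewrite /g indicE mem_set// mulr1.
have gout x : ~ @box R K abs n k x -> g x = 0.
  by move=> xk; rewrite /g indicE memNset// mulr0.
have mg : measurable_fun setT g.
  apply: measurable_funM => //; apply: measurable_indic; exact: (measurable_box tame).
have gfin : (\int[m]_x (g x)%:E)%E \is a fin_num.
  rewrite ge0_fin_numE; last by apply: integral_ge0 => x _; rewrite lee_fin.
  rewrite (@le_lt_trans _ _ (b ^+ n)%:E) ?ltry// -VI.
  by apply: ge0_le_integral_nonmeasurable => x; rewrite lee_fin.
pose beta := fine (\int[m]_x (g x)%:E)%E.
have gE : (\int[m]_x (g x)%:E = beta%:E)%E by rewrite fineK.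
have {kP} beta_ge : a' * b ^+ n / q <= beta by rewrite -lee_fin -gE.
have beta0 : 0 < beta.
  by apply: lt_le_trans beta_ge; rewrite divr_gt0// mulr_gt0// (le_lt_trans a0).
(* The default [set0] of [nth] is never reached: [J j] is used for [j < N]. *)
pose Js : seq (set K) := fset_set (fd_partition (data_of K) delta).
pose J j := nth set0 Js j.
have PJ j : (j < N)%N -> fd_partition (data_of K) delta (J j).
  by move=> jN; have := mem_nth set0 jN; rewrite in_fset_set// => /set_mem.
have /choice[xi0 xi0P] : forall j, exists xi0, (j < N)%N -> forall t, 0 < t ->
    exists A : set (lf_space K), [/\ measurable A, A `<=` J j,
      forall xi, A xi -> abs (xi - xi0) <= t & (0 < haar K A < +oo)%E].
  move=> j; have [jN|jN] := ltnP j N; last by exists 0.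
  by have [_ _ [x0 h]] := Ppiece _ (PJ j jN); exists x0 => _; exact: h.
pose z j x := phase gamma (xi0 j) x.
have z1 j x : cmod (z j x) = 1 by rewrite (tame_char_cmod tame).
have [zeta zetaP] := @closed_prim_root_exists R[i] n.+1 isT.
pose D eps x := \sum_(j < N) eps`_j * z j x.
have mD eps : cmeasurable setT (D eps : n.-tuple (lf_space K) -> R[i]).
  apply: cmeasurable_sum => j; apply: cmeasurableM; first exact: cmeasurable_cst.
  exact: (cmeasurable_phase_x tame).
pose s := phase_vectors n.+1 zeta N.
have size_s : size s = (n.+1 ^ N)%N by rewrite size_phase_vectors.
have [||||||||eps eps_s epsP] := @exists_ge_average _ _ _ m _ s
    (fun eps x => cmod (D eps x) ^+ (2 * n) * g x) g A0 beta.
- by rewrite -size_eq0 size_s -lt0n expn_gt0.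
- by move=> eps; apply: measurable_funM => //; exact: measurable_cmodX.
- by move=> eps x; rewrite mulr_ge0// exprn_ge0// cmod_ge0.
- by [].
- by [].
- by rewrite /A0.
- by [].
- move=> x; rewrite -mulr_suml ler_wpM2r// size_s -natrM.
  exact: (moment_cmod (z := fun j => z j x)).
(* [E f] and [D] differ by at most [L * t] on the box, hence their powers by at most
   [C * t]; the second bound on [t] makes this fit between [q] and [A0], and the
   first one keeps the square function away from zero. *)
pose L : R := N%:R; have L1 : 1 <= L by rewrite /L ler1n.
have L0 : 0 < L by exact: lt_le_trans L1.
pose C := (2 * n)%:R * L ^+ (2 * n) * L.
have C0 : 0 <= C by rewrite !mulr_ge0// ?exprn_ge0// ltW.
pose t := Num.min 2^-1 ((A0 - q) / (C + 1)).
have t0 : 0 < t by rewrite lt_min invr_gt0 ltr0n/= divr_gt0 ?subr_gt0// ltr_wpDl.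
have t12 : t <= 2^-1 by rewrite ge_min lexx.
have Ct : C * t <= A0 - q.
  apply: (@le_trans _ _ ((C + 1) * t)); first by rewrite ler_wpM2r ?lerDl// ltW.
  by rewrite mulrC -ler_pdivlMr ?ltr_wpDl// ge_min lexx orbT.
have /choice[A AP] : forall j : 'I_N, exists A : set (lf_space K),
   [/\ measurable A, A `<=` J j, (0 < haar K A < +oo)%E &
     forall x, @box R K abs n k x -> cmod (averaged_phase gamma A x - z j x) <= t].
  move=> j; have [r r0 rP] := phase_near tame gamma (xi0 j) k%:R t0.
  have [A [mA AJ Ar A0']] := xi0P j (ltn_ord j) r r0.
  exists A; split => // x xk; apply: (averaged_phase_near tame) => //; last exact: ltW.
  by move=> xi /Ar/rP; apply.
have mA j : measurable (A j) by case: (AP j).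
have AJ j : A j `<=` J j by case: (AP j).
have hA j : (0 < haar K (A j) < +oo)%E by case: (AP j).
have Anear j x : @box R K abs n k x -> cmod (averaged_phase gamma (A j) x - z j x) <= t.
  by case: (AP j) => _ _ _; apply.
have An0 j : A j !=set0.
  apply/set0P/eqP => Aj0; have /andP[] := hA j.
  by rewrite Aj0 measure0 ltxx.
clear AP xi0P.
pose e (j : 'I_N) := eps`_j; pose u j x := averaged_phase gamma (A j) x.
have e1 j : cmod (e j) = 1.
  have := norm_phase_vectors zetaP eps_s (ltn_ord j).
  by rewrite normr_cmod => /(congr1 (@complex.Re R)).
have u1 j x : cmod (u j x) <= 1 by exact: (averaged_phase_le1 tame).
pose f := concentrated e A.
have subJ (i j : 'I_N) : A i `<=` J j -> i = j.
  move=> AiJj; apply/val_inj/eqP => /=.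
  rewrite -(nth_uniq set0 (ltn_ord i) (ltn_ord j) (fset_uniq _)); apply/eqP.
  have [x Ax] := An0 i; apply: Pdisj; [exact: PJ|exact: PJ|].
  by exists x; split; [exact: AJ|exact: AiJj].
have disJ (i j : 'I_N) : A i `<=` J j \/ A i `&` J j = set0.
  have [->|ij] := eqVneq i j; first by left; exact: AJ.
  right; apply/seteqP; split => // x [/AJ Jix Jjx].
  case/eqP: ij; apply/val_inj/eqP => /=.
  rewrite -(nth_uniq set0 (ltn_ord i) (ltn_ord j) (fset_uniq _)); apply/eqP.
  by apply: Pdisj; [exact: PJ|exact: PJ|exists x].
have Acell j : A j `<=` fd_cell (data_of K).
  by have [_ Jcell _] := Ppiece _ (PJ j (ltn_ord j)); exact: subset_trans Jcell.
have cellE x : extension gamma (fd_cell (data_of K)) f x = \sum_(j < N) e j * u j x.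
  rewrite (extension_concentrated tame gamma e mA).
  - by apply: eq_bigr => j _; rewrite asboolT.
  - exact: (tame_cell_measurable tame).
  - exact: (tame_cell_finite tame).
  - by move=> j; left.
have JE (i : 'I_N) x : extension gamma (J i) f x = e i * u i x.
  have [mJ Jcell _] := Ppiece _ (PJ i (ltn_ord i)).
  rewrite (extension_concentrated tame gamma e mA) => //.
  - rewrite (bigD1 i)//= asboolT ?big1 ?addr0// => j ji.
    by rewrite asboolF// => /subJ /eqP; apply/negP.
  - apply: le_lt_trans (tame_cell_finite tame).
    by apply: le_measure => //; apply/mem_set => //; exact: (tame_cell_measurable tame).
have SE x : square_function gamma delta f x ^+ 2 = \sum_(i < N) cmod (u i x) ^+ 2.
  rewrite /square_function fsbig_finite// sqr_sqrtr; last first.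
    by apply: sumr_ge0 => i _; exact: sqr_ge0.
  rewrite (big_nth set0) big_mkord; apply: eq_bigr => i _.
  by rewrite [X in cmod X](JE i x) cmodM e1 mul1r.
have S_le x : square_function gamma delta f x ^+ (2 * n) <= L ^+ n.
  rewrite exprM SE lerXn2r ?nnegrE ?sumr_ge0 ?(ltW L0)//.
    by move=> i _; exact: sqr_ge0.
  rewrite -[L]/(N%:R) -[N in leRHS]card_ord -sumr_const ler_sum// => i _.
  by rewrite expr_le1// cmod_ge0.
have S_ge x : @box R K abs n k x -> 2^-1 ^+ (2 * n) <= square_function gamma delta f x ^+ (2 * n).
  move=> xk; rewrite !exprM SE lerXn2r ?nnegrE ?sumr_ge0 ?exprn_ge0//.
    by move=> i _; exact: sqr_ge0.
  rewrite (bigD1 (Ordinal N0))//; apply: ler_wpDr.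
    by apply: sumr_ge0 => i _; exact: sqr_ge0.
  rewrite lerXn2r ?nnegrE ?cmod_ge0//.
  set j := Ordinal N0.
  have h1 := Anear j x xk; have h2 := cmodD (z j x - u j x) (u j x).
  rewrite subrK z1 -opprB cmodN in h2.
  by rewrite /u in h1 h2 *; lra.
have E_ge x : @box R K abs n k x ->
    cmod (D eps x) ^+ (2 * n) <= cmod (extension gamma (fd_cell (data_of K)) f x) ^+ (2 * n) + C * t.
  move=> xk.
  have -> : C * t = (2 * n)%:R * L ^+ (2 * n) * (L * t) by rewrite /C mulrA.
  apply: pow_perturb => //; [|exact: cmod_ge0| |].
  - rewrite cmod_ge0/= (le_trans (cmod_sum _ _))//.
    rewrite -[L]/(N%:R) -[N in leRHS]card_ord -sumr_const ler_sum// => j _.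
    by rewrite cmodM e1 mul1r z1.
  - by rewrite mulr_ge0// ltW.
  have -> : D eps x = extension gamma (fd_cell (data_of K)) f x +
      \sum_(j < N) e j * (z j x - u j x).
    by rewrite cellE -big_split/=; apply: eq_bigr => j _; rewrite -mulrDr addrC subrK.
  rewrite (le_trans (cmodD _ _))// lerD2l (le_trans (cmod_sum _ _))//.
  rewrite mulr_natl -[N in leRHS]card_ord -sumr_const ler_sum// => j _.
  by rewrite cmodM e1 mul1r -opprB cmodN Anear.
have den_le : (moment (square_function gamma delta f) <= (L ^+ n * b ^+ n)%:E)%E.
  rewrite momentE EFinM -VI -ge0_integralZl//; last 3 first.
  - exact/measurable_EFinP.
  - by move=> x _; rewrite lee_fin.
  - by rewrite lee_fin exprn_ge0// ltW.
  apply: ge0_le_integral_nonmeasurable => x; rewrite -?EFinM lee_fin.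
    by rewrite mulr_ge0// exprn_ge0// sqrtr_ge0.
  by rewrite ler_wpM2r.
exists f; split.
- exact: (admissible_concentrated tame).
- rewrite momentE; apply/andP; split.
    apply: (@lt_le_trans _ _ (2^-1 ^+ (2 * n) * beta)%:E).
      by rewrite lte_fin mulr_gt0// exprn_gt0.
    rewrite EFinM -gE -ge0_integralZl//; last 2 first.
    - exact/measurable_EFinP.
    - by move=> x _; rewrite lee_fin.
    apply: ge0_le_integral_nonmeasurable => x; rewrite -EFinM lee_fin.
      by rewrite mulr_ge0// exprn_ge0.
    have [xk|xk] := pselect (@box R K abs n k x).
      by rewrite gin// ler_wpM2r// S_ge.
    by rewrite gout// mulr0 mulr_ge0// exprn_ge0// sqrtr_ge0.
  rewrite -momentE; apply: le_lt_trans den_le _; exact: ltry.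
apply: (@le_trans _ _ (a * b ^+ n)%:E).
  apply: (le_trans (lee_wpmul2l _ den_le)).
    by rewrite lee_fin divr_ge0// exprn_ge0.
  by rewrite -EFinM lee_fin mulrA divfK// expf_neq0// gt_eqF.
(* [h] is a measurable minorant of the numerator; subtracting [C * t] inside the
   integral would give a function of changing sign. *)
pose h (x : n.-tuple (lf_space K)) : R := Num.max 0 (cmod (D eps x) ^+ (2 * n) - C * t) * g x.
have h0 x : 0 <= h x by rewrite mulr_ge0// le_max lexx.
have mh : measurable_fun setT h.
  apply: measurable_funM => //; apply: measurable_maxr => //.
  by apply: measurable_funB => //; exact: measurable_cmodX.
apply: (@le_trans _ _ (\int[m]_x (h x)%:E)%E); last first.
  rewrite momentE; apply: ge0_le_integral_nonmeasurable => x; rewrite lee_fin//.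
  rewrite /h; have [xk|xk] := pselect (@box R K abs n k x).
    rewrite gin// ler_wpM2r// ge_max lerBlDr E_ge// andbT.
    by rewrite exprn_ge0// cmod_ge0.
  by rewrite gout// mulr0 mulr_ge0// exprn_ge0// cmod_ge0.
rewrite -(@leeD2rE _ (C * t * beta)%:E)//.
apply: (@le_trans _ _ (A0 * beta)%:E).
  rewrite -EFinD lee_fin.
  have h1 : C * t * beta <= (A0 - q) * beta by rewrite ler_wpM2r// ltW.
  have h2 : a' * b ^+ n <= q * beta by rewrite [leRHS]mulrC -ler_pdivrMr.
  have h3 : a * b ^+ n <= a' * b ^+ n by rewrite ler_wpM2r ?(ltW bn0)// ltW.
  lra.
apply: (le_trans epsP).
have -> : ((C * t * beta)%:E = \int[m]_x (C * t * g x)%:E)%E.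
  under eq_integral do rewrite EFinM.
  rewrite ge0_integralZl//.
  - by rewrite gE.
  - exact/measurable_EFinP.
  - by move=> x _; rewrite lee_fin.
  - by rewrite lee_fin mulr_ge0// ltW.
rewrite -ge0_integralD//; last 4 first.
- by move=> x _; rewrite lee_fin.
- exact/measurable_EFinP.
- by move=> x _; rewrite lee_fin mulr_ge0// mulr_ge0// ltW.
- by apply/measurable_EFinP; apply: measurable_funM.
apply: ge0_le_integral_nonmeasurable => x.
  by rewrite lee_fin mulr_ge0// exprn_ge0// cmod_ge0.
rewrite -EFinD lee_fin /h -mulrDl ler_wpM2r//.
by rewrite -lerBlDr le_max lexx orbT.
Qed.
(** As [N] grows, [n! * (N)_n / N ^ n] exceeds any [c < n!]. *)
Lemma square_function_constant_ge (c : R) : 0 <= c < n`!%:R ->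
  ((c `^ (2 * n)%:R^-1)%:E <= square_function_constant gamma w)%E.
Proof.
move=> /andP[c0 cn].
have [k kP] : exists k : nat, forall N, (k <= N)%N -> (0 < N)%N ->
    c * N%:R ^+ n < (n`! * N ^_ n)%:R.
  have nf0 : 0 < n`!%:R :> R by rewrite ltr0n fact_gt0.
  (* By [ffact_ratio] it suffices that [n! * n ^ 2 / N] is smaller than [n! - c]. *)
  pose r := n`!%:R * (n ^ 2)%:R / (n`!%:R - c).
  exists (Num.truncn r).+1 => N kN N0.
  have N0' : 0 < N%:R :> R by rewrite ltr0n.
  have rN : r < N%:R.
    rewrite (lt_le_trans (truncnS_gt _))// ler_nat//.
  rewrite -ltr_pdivlMr ?exprn_gt0// natrM -mulrA.
  apply: (lt_le_trans _ (ler_wpM2l (ltW nf0) (ffact_ratio n N0))).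
  move: rN; rewrite /r ltr_pdivrMr ?subr_gt0// => rN.
  rewrite mulrBr mulr1 ltrBrDr -ltrBrDl mulrA ltr_pdivrMr// mulrC.
  by rewrite mulrC [ltRHS]mulrC.
have [delta sdelta [hP kN]] := tame_partition tame (maxn k 1).
rewrite geq_max in kN; case/andP: kN => kN N0.
set N := #|` _| in kN N0.
have ca : 0 <= c * N%:R ^+ n < (n`! * N ^_ n)%:R.
  by rewrite mulr_ge0 ?exprn_ge0//= kP.
have [f [adm /andP[den0 denoo] le_num]] :=
  exists_test_function sdelta N0 hP ca.
rewrite mulfK in le_num; last by rewrite expf_neq0// pnatr_eq0 -lt0n.
set V := dilated_weight _ _ _ in den0 denoo le_num.
set den := integral _ _ _ in den0 denoo le_num.
set num := integral _ _ _ in le_num.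
set p : R := (2 * n)%:R^-1.
have p0 : 0 < p by rewrite invr_gt0 ltr0n muln_gt0 n0.
have den_fin : den \is a fin_num by rewrite ge0_fin_numE// ltW.
have den1 : 0 < fine den by rewrite fine_gt0// den0.
have denE : den = (fine den)%:E by rewrite fineK.
have num0 : (0 <= num)%E.
  by apply: le_trans le_num; rewrite mule_ge0// ?lee_fin// ltW.
apply: (@le_trans _ _ (num `^ p / den `^ p)%E); last first.
  apply: ereal_sup_ubound => /=; exists delta, [tuple 0 | i < n], f; split => //.
  by rewrite poweR_eq0 ?(ltW den0)// negb_and gt_eqF.
rewrite denE poweR_EFin inver gt_eqF ?powR_gt0//.
rewrite lee_pdivlMr ?powR_gt0// -EFinM -powRM ?(ltW den1)// -poweR_EFin.
apply: gt0_ler_poweR; rewrite ?in_itv/= ?leey ?andbT ?(ltW p0)//.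
  by rewrite lee_fin mulr_ge0// ltW.
by rewrite EFinM -denE.
Qed.

Theorem tame_square_function_constant :
  ((n`!%:R `^ (2 * n)%:R^-1)%:E <= square_function_constant gamma w)%E.
Proof.
set p : R := (2 * n)%:R^-1.
have n20 : (0 < 2 * n)%N by rewrite muln_gt0.
apply/lee_addgt0Pr => e e0; rewrite -leeBlDr// -EFinB.
have powK (y : R) : 0 <= y -> (y ^+ (2 * n)) `^ p = y.
  move=> y0; rewrite -powR_mulrn// -powRrM mulfV ?powRr1//.
  by rewrite pnatr_eq0 -lt0n.
pose y := Num.max 0 (n`!%:R `^ p - e).
have y0 : 0 <= y by rewrite le_max lexx.
apply: (@le_trans _ _ y%:E); first by rewrite lee_fin le_max lexx orbT.
rewrite -(powK y y0); apply: square_function_constant_ge.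
rewrite exprn_ge0//=.
have nf0 : 0 < n`!%:R :> R by rewrite ltr0n fact_gt0.
have -> : n`!%:R = (n`!%:R `^ p) ^+ (2 * n) :> R.
  by rewrite -powR_mulrn ?powR_ge0// -powRrM mulVf ?powRr1 ?(ltW nf0)// pnatr_eq0 -lt0n.
have np0 : 0 < n`!%:R `^ p :> R by exact: powR_gt0.
rewrite ltrXn2r ?nnegrE ?powR_ge0 -?lt0n//.
by rewrite gt_max np0 gtrBl.
Qed.

End Generic.

(** * The real field *)

Lemma size_fset_set_ge (T : choiceType) (P : set T) N (F : nat -> T) :
  finite_set P -> (forall j, (j < N)%N -> P (F j)) ->
  {in [pred j | j < N]%N &, injective F} -> (N <= size (fset_set P))%N.
Proof.
move=> Pfin PF Finj; rewrite -[leqLHS](size_iota 0) -(size_map F).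
apply: uniq_leq_size.
  rewrite map_inj_in_uniq ?iota_uniq// => i j; rewrite !mem_iota/= !add0n.
  exact: Finj.
move=> x /mapP[j]; rewrite mem_iota /= add0n => jN ->.
by rewrite in_fset_set//; apply/mem_set/PF.
Qed.

Section RealLine.
Context {R : realType}.

Lemma real_charD (x y : R) : real_char (x + y) = real_char x * real_char y.
Proof.
rewrite /real_char mulrDr cosD sinD; apply/eqP; rewrite eq_complex/=.
by apply/andP; split; apply/eqP; ring.
Qed.

Lemma cmod_real_char (x : R) : cmod (real_char x) = 1.
Proof.
apply/eqP; rewrite -(@pexpr_eq1 _ _ 2)// ?cmod_ge0// cmod_sqr /= sqrrN.
by rewrite cos2Dsin2.
Qed.

Lemma continuous_near_le (f : R -> R) (x0 eta : R) : continuous f -> 0 < eta ->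
  exists2 t, 0 < t & forall x, `|x - x0| <= t -> `|f x - f x0| <= eta.
Proof.
move=> cf eta0; have /cvgrPdist_le /(_ _ eta0) /nbhs_ballP[e /= e0 eP] := cf x0.
exists (e / 2); first by rewrite divr_gt0.
move=> x xe; rewrite distrC; apply: eP; rewrite /ball/= distrC.
by rewrite (le_lt_trans xe)// ltr_pdivrMr// ltr_pMr// ltr1n.
Qed.

Lemma real_char_near1 (eta : R) : 0 < eta ->
  exists2 t, 0 < t & forall x : R, `|x| <= t -> cmod (real_char x - 1) <= eta.
Proof.
move=> eta0; have e20 : 0 < eta / 2 by rewrite divr_gt0.
have cc : continuous (fun x : R => cos (2 * pi * x)).
  by move=> x; apply: continuous_comp; [exact: mulrl_continuous|exact: continuous_cos].
have cs : continuous (fun x : R => sin (2 * pi * x)).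
  by move=> x; apply: continuous_comp; [exact: mulrl_continuous|exact: continuous_sin].
have [t t0 tP] := continuous_near_le 0 cc e20.
have [s s0 sP] := continuous_near_le 0 cs e20.
exists (Num.min t s); first by rewrite lt_min t0.
move=> x; rewrite le_min => /andP[xt xs].
rewrite (le_trans (cmod_le_re_im _))//= (splitr eta) lerD//.
  by have := tP x; rewrite subr0 mulr0 cos0; apply.
by have := sP x; rewrite !subr0 mulr0 sin0 !subr0 normrN; apply.
Qed.

Lemma cmeasurable_real_char d (T : measurableType d) (f : T -> R) :
  measurable_fun setT f -> cmeasurable setT (fun x => real_char (f x)).
Proof.
move=> mf; split => /=.
  apply: (measurableT_comp (f := fun x : R => cos (2 * pi * x))) => //.
  apply: continuous_measurable_fun => x.
  by apply: continuous_comp; [exact: mulrl_continuous|exact: continuous_cos].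
apply: (measurableT_comp (f := fun x : R => - sin (2 * pi * x))) => //.
apply: measurableT_comp => //; apply: continuous_measurable_fun => x.
by apply: continuous_comp; [exact: mulrl_continuous|exact: continuous_sin].
Qed.

Definition subinterval (N j : nat) : set R := `[j%:R * N%:R^-1, j.+1%:R * N%:R^-1[.

Lemma real_partitionE N : (0 < N)%N ->
  real_partition (N%:R^-1 : R) = [set subinterval N j | j in `I_N].
Proof.
move=> N0; rewrite /real_partition; congr image; apply/seteqP; split => j /=.
  by rewrite invrK lerBrDr natr1 ler_nat.
by rewrite invrK lerBrDr natr1 ler_nat.
Qed.

Lemma subinterval_left N j : (0 < N)%N -> subinterval N j (j%:R * N%:R^-1 : R).
Proof.
move=> N0; rewrite /subinterval/= in_itv/= lexx ltr_pM2r ?ltr_nat//.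
  by rewrite ltnSn.
by rewrite invr_gt0 ltr0n.
Qed.

Lemma subinterval_disjoint N i j : (0 < N)%N ->
  subinterval N i `&` subinterval N j !=set0 -> i = j.
Proof.
move=> N0 [x []]; rewrite /subinterval/= !in_itv/= => /andP[ix xi] /andP[jx xj].
have N1 : 0 < N%:R^-1 :> R by rewrite invr_gt0 ltr0n.
apply/eqP; rewrite eqn_leq -(ltnS i) -(ltnS j).
have := le_lt_trans ix xj; rewrite ltr_pM2r// ltr_nat => ->.
by have := le_lt_trans jx xi; rewrite ltr_pM2r// ltr_nat => ->.
Qed.

Lemma subinterval_inj N i j : (0 < N)%N -> subinterval N i = subinterval N j -> i = j.
Proof.
move=> N0 ij; apply: (subinterval_disjoint N0); exists (i%:R * N%:R^-1).
by split; [|rewrite -ij]; exact: subinterval_left.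
Qed.

Lemma subinterval_sub01 N j : (j < N)%N -> subinterval N j `<=` `[0, 1].
Proof.
move=> jN x; rewrite /subinterval/= !in_itv/= => /andP[jx xj].
have N0 : (0 < N)%N by exact: leq_ltn_trans jN.
rewrite (le_trans _ jx) ?mulr_ge0 ?invr_ge0//= (le_trans (ltW xj))//.
by rewrite ler_pdivrMr ?ltr0n// mul1r ler_nat.
Qed.

Lemma measurable_subinterval N j : measurable (subinterval N j : set (measurableTypeR R)).
Proof. exact: measurable_itv. Qed.

Lemma subinterval_small N j (t : R) : (0 < N)%N -> 0 < t ->
  exists A : set R, [/\ measurable (A : set (measurableTypeR R)), A `<=` subinterval N j,
    forall x, A x -> `|x - j%:R * N%:R^-1| <= t &
    exists2 s : R, 0 < s & lebesgue_measure A = s%:E].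
Proof.
move=> N0 t0; set x0 : R := j%:R * N%:R^-1.
have N1 : 0 < N%:R^-1 :> R by rewrite invr_gt0 ltr0n.
pose s := Num.min t (N%:R^-1 : R).
have s0 : 0 < s by rewrite lt_min t0.
exists `[x0, x0 + s[%classic; split.
- exact: measurable_itv.
- move=> x /=; rewrite /subinterval/= !in_itv/= => /andP[-> xs]/=.
  by rewrite (lt_le_trans xs)// -natr1 mulrDl mul1r lerD2l ge_min lexx orbT.
- move=> x /=; rewrite in_itv/= => /andP[xx xs].
  rewrite ger0_norm ?subr_ge0// lerBlDl (le_trans (ltW xs))// lerD2l.
  by rewrite ge_min lexx.
exists s => //; rewrite lebesgue_measure_itv/= lte_fin ltrDl s0 -EFinD.
by rewrite addrAC subrr add0r.
Qed.

(** By the Schwartz bounds [w (x / r)] is at most a multiple of [1 / (1 + x ^ 2)],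
    whose integral is [pi].  The integral is at least [1] as the dilate is at
    least [1] on the unit interval. *)
Lemma schwartz_dilate_integrable (w : R -> R) (r : R) : weight_generator w -> 1 <= r ->
  measurable_fun setT (fun x : measurableTypeR R => w (x / r)) /\
  exists2 b : R, 0 < b & (\int[@lebesgue_measure R]_x (w (x / r))%:E = b%:E)%E.
Proof.
move=> [[dw bw] w0 w1 _ _] r1; have r0 : 0 < r by exact: lt_le_trans r1.
have cw : continuous w.
  move=> x; apply/differentiable_continuous/derivable1_diffP.
  by have := dw 0%N x; rewrite derive1n0.
have cwr : continuous (fun x : R => w (x / r)).
  by move=> x; apply: continuous_comp; [exact: mulrr_continuous|exact: cw].
have mw : measurable_fun setT (fun x : measurableTypeR R => w (x / r)).
  exact: continuous_measurable_fun.
split => //.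
have [C0 C0P] := bw 0%N 0%N; have [C2 C2P] := bw 0%N 2%N.
pose C := C0 + r ^+ 2 * C2.
have wC x : w (x / r) <= C * (oneDsqr x)^-1.
  rewrite ler_pdivlMr ?(lt_le_trans ltr01 (oneDsqr_ge1 x))//.
  rewrite /oneDsqr mulrDr mulr1 /C lerD//.
    by have := C0P (x / r); rewrite expr0 mul1r derive1n0 ger0_norm.
  have := C2P (x / r); rewrite derive1n0 (ger0_norm (w0 _)) real_normK ?num_real// => h.
  apply: le_trans (ler_wpM2l (sqr_ge0 r) h).
  have -> : r ^+ 2 * ((x / r) ^+ 2 * w (x / r)) = w (x / r) * x ^+ 2.
    by set W := w _; field; rewrite gt_eqF.
  by [].
have C_ge0 : 0 <= C.
  by have := le_trans (w0 _) (wC 0); rewrite pmulr_lge0// invr_gt0 (lt_le_trans ltr01 (oneDsqr_ge1 _)).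
have upper : (\int[@lebesgue_measure R]_x (w (x / r))%:E <= (C * pi)%:E)%E.
  apply: (@le_trans _ _ (\int[@lebesgue_measure R]_x (C * (oneDsqr x)^-1)%:E)%E).
    by apply: ge0_le_integral_nonmeasurable => x; rewrite lee_fin.
  under eq_integral do rewrite EFinM.
  have V0 (x : R) : 0 <= (oneDsqr x)^-1.
    by rewrite invr_ge0 (le_trans ler01 (oneDsqr_ge1 x)).
  rewrite ge0_integralZl//; last first.
    apply/measurable_EFinP; apply: continuous_measurable_fun.
    exact: continuous_oneDsqrV.
  rewrite EFinM lee_wpmul2l ?lee_fin//.
  rewrite ge0_symfun_integralT//; last 2 first.
  - exact: continuous_oneDsqrV.
  - by move=> x /=; rewrite /oneDsqr sqrrN.
  rewrite -set_itvcy integral0y_oneDsqr -EFinM lee_fin mulrC divfK//.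
have lower : (1 <= \int[@lebesgue_measure R]_x (w (x / r))%:E)%E.
  have <- : (\int[@lebesgue_measure R]_x (\1_`[0, 1] x : R)%:E = 1)%E.
    rewrite integral_indic// setIT.
    transitivity (@lebesgue_measure R `[0, 1]%classic); first by [].
    rewrite lebesgue_measure_itv/= lte_fin ltr01.
    by rewrite oppr0 adde0.
  apply: ge0_le_integral_nonmeasurable => x; rewrite lee_fin// indicE.
  case: (boolP (_ \in _)) => [/set_mem/=|_]; last exact: w0.
  rewrite in_itv/= => /andP[x0 x1]; apply: w1.
  by rewrite divr_ge0 ?(ltW r0)//= ler_pdivrMr// mul1r (le_trans x1).
exists (fine (\int[@lebesgue_measure R]_x (w (x / r))%:E)%E).
  by rewrite fine_gt0// (lt_le_trans _ lower) ?lte01//= (le_lt_trans upper) ?ltry.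
rewrite fineK// ge0_fin_numE ?(le_lt_trans upper) ?ltry//.
by apply: le_trans lower.
Qed.

End RealLine.

Section TameReal.
Context {R : realType}.

Lemma archimedean_scale_inv (delta : R) : archimedean_scales delta ->
  exists2 N : nat, (0 < N)%N & delta = N%:R^-1.
Proof. by move=> [N N0 <-]; exists N. Qed.

Lemma archimedean_scale_ge1 (delta : R) n : archimedean_scales delta -> 1 <= delta ^- n.
Proof.
move=> /archimedean_scale_inv[N N0 ->].
by rewrite exprVn invrK -natrX ler1n expn_gt0 N0.
Qed.

Lemma tame_real (w : R -> R) : weight_generator w ->
  tame_field w (K := LFReal R) (fun x : R => `|x|).
Proof.
move=> hw; split.
- exact: normr0.
- exact: normr_ge0.
- exact: ler_normD.
- exact: normrM.
- move=> r; rewrite (_ : [set x | _] = `[- r, r]%classic); first exact: measurable_itv.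
  by apply/seteqP; split => x /=; rewrite in_itv/= ler_norml.
- move=> r; rewrite (_ : [set x | _] = `[- r, r]%classic); last first.
    by apply/seteqP; split => x /=; rewrite in_itv/= ler_norml.
  apply: (@le_lt_trans _ _ (@lebesgue_measure R `[- r, r]%classic)); first by [].
  by rewrite lebesgue_measure_itv/=; case: ifP => _; rewrite ?ltry// -EFinD ltry.
- exact: real_charD.
- exact: cmod_real_char.
- exact: real_char_near1.
- move=> p; apply: cmeasurable_real_char; apply: continuous_measurable_fun.
  exact: continuous_horner.
- exact: (@segment_compact R 0 1).
- exact: (@itv_closed _ R 0 1).
- exact: measurable_itv.
- apply: (@le_lt_trans _ _ (@lebesgue_measure R `[0, 1]%classic)); first by [].
  by rewrite lebesgue_measure_itv/=; case: ifP => _; rewrite ?ltry// -EFinD ltry.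
- move=> N0; pose N := maxn N0 1.
  have Ngt0 : (0 < N)%N by rewrite leq_max orbT.
  exists (N%:R^-1); first by exists N.
  rewrite /= real_partitionE//; split; first split.
  + exact: finite_image.
  + by move=> _ _ [i _ <-] [j _ <-] /(subinterval_disjoint Ngt0) ->.
  + move=> _ [j /= jN <-]; split.
    * exact: measurable_subinterval.
    * exact: subinterval_sub01.
    exists (j%:R * N%:R^-1) => t t0.
    have [A [mA AJ At [s s0 As]]] := @subinterval_small R N j t Ngt0 t0.
    exists A; split => //.
    apply/andP; split; [apply: (@lt_le_trans _ _ s%:E)|apply: (@le_lt_trans _ _ s%:E)].
    * by rewrite lte_fin.
    * by rewrite -As.
    * by rewrite -As.
    * exact: ltry.
  + apply: (@size_fset_set_ge _ _ _ (subinterval N)).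
    * exact: finite_image.
    * by move=> j jN; exists j => //=; rewrite (leq_trans jN)// leq_maxl.
    * by move=> i j _ _; exact: subinterval_inj.
- move=> n delta sdelta; pose r := delta ^- n.
  have [mv [b b0 vb]] := schwartz_dilate_integrable hw (archimedean_scale_ge1 n sdelta).
  exists (fun x : R => w (x / r)), b; split => //.
  + by move=> x; case: hw.
  + move=> x; rewrite /dilated_weight /= /real_weight; apply: eq_bigr => i _.
    by rewrite !tnth_mktuple subr0.
Qed.

End TameReal.

(** * The complex field *)

Section TameComplex.
Context {R : realType}.
Local Notation Re := (@complex.Re R).
Local Notation Im := (@complex.Im R).
Local Notation lambda := (@lebesgue_measure R).

Lemma measurable_re_im_preimage (B : set (measurableTypeR R * measurableTypeR R)) :
  measurable B -> measurable (@re_im R @^-1` B : set (complex_space R)).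
Proof. by move=> mB; exists B => //; rewrite setTI. Qed.

Lemma measurable_rectangle (A B : set (measurableTypeR R)) : measurable A -> measurable B ->
  measurable ([set z | A (Re z) /\ B (Im z)] : set (complex_space R)).
Proof. by move=> mA mB; apply: (measurable_re_im_preimage (B := A `*` B)); exact: measurableX. Qed.

Lemma cmeasurable_id : cmeasurable setT (fun z : complex_space R => z : R[i]).
Proof.
split=> _ Y mY; rewrite setTI.
  apply: (measurable_re_im_preimage (B := fst @^-1` Y)).
  by rewrite -[X in measurable X]setTI; exact: measurable_fst.
apply: (measurable_re_im_preimage (B := snd @^-1` Y)).
by rewrite -[X in measurable X]setTI; exact: measurable_snd.
Qed.

Definition mk_complex (p : measurableTypeR R * measurableTypeR R) : complex_space R :=
  (p.1 +i* p.2)%C.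

Lemma measurable_mk_complex : measurable_fun setT mk_complex.
Proof.
move=> _ _ [B mB <-]; rewrite !setTI.
by rewrite (_ : _ @^-1` _ = B)//; apply/seteqP; split => -[].
Qed.

Lemma complex_lebesgue_rectangle (A B : set (measurableTypeR R)) :
  measurable A -> measurable B ->
  complex_lebesgue ([set z | A (Re z) /\ B (Im z)]) = (lambda A * lambda B)%E.
Proof.
move=> mA mB; rewrite -product_measure1E//; congr (_ \x _)%E.
Qed.

(** The measure on the plane is the image of the product of two Lebesgue measures
    under [mk_complex]. *)
Lemma integral_complex_lebesgue_prod (f g : measurableTypeR R -> R) (a b : R) :
  measurable_fun setT f -> measurable_fun setT g ->
  (forall x, 0 <= f x) -> (forall x, 0 <= g x) ->
  (\int[lambda]_x (f x)%:E = a%:E)%E -> (\int[lambda]_x (g x)%:E = b%:E)%E ->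
  measurable_fun setT (fun z : complex_space R => f (Re z) * g (Im z)) /\
  (\int[@complex_lebesgue R]_z (f (Re z) * g (Im z))%:E = (a * b)%:E)%E.
Proof.
move=> mf mg f0 g0 fa gb.
have [mRe mIm] := cmeasurable_id.
have mfg : measurable_fun setT (fun z : complex_space R => f (Re z) * g (Im z)).
  by apply: measurable_funM; [exact: (measurableT_comp mf mRe)|exact: (measurableT_comp mg mIm)].
split => //.
transitivity (\int[pushforward (lambda \x lambda) mk_complex]_z (f (Re z) * g (Im z))%:E)%E.
  by [].
rewrite ge0_integral_pushforward//; last 3 first.
- exact: measurable_mk_complex.
- exact/measurable_EFinP.
- by move=> z _; rewrite lee_fin mulr_ge0.
rewrite preimage_setT fubini_tonelli1//=; last 2 first.
- apply/measurable_EFinP; exact: (measurableT_comp mfg measurable_mk_complex).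
- by move=> z; rewrite lee_fin mulr_ge0.
rewrite /fubini_F /=; under eq_integral => x _.
  under eq_integral do rewrite EFinM.
  rewrite ge0_integralZl//; last 3 first.
  - exact/measurable_EFinP.
  - by move=> t _; rewrite lee_fin.
  - by rewrite lee_fin.
  rewrite gb muleC.
over.
rewrite ge0_integralZl//; last 3 first.
- exact/measurable_EFinP.
- by move=> t _; rewrite lee_fin.
- by rewrite -gb integral_ge0// => x _; rewrite lee_fin.
by rewrite fa mulrC EFinM.
Qed.

Definition unit_square : set R[i] := [set z | 0 <= Re z <= 1 /\ 0 <= Im z <= 1].

(** The topology is that of a normed field over the partially ordered [R[i]], so
    the square is obtained as the continuous image of a product of two segments. *)
Lemma compact_unit_square : compact (unit_square : set R[i]^o).
Proof.
pose mk (p : R^o * R^o) : R[i]^o := (p.1 +i* p.2)%C.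
have -> : unit_square = mk @` (`[0, 1]%classic `*` `[0, 1]%classic).
  apply/seteqP; split => [[a b] [/= ha hb]|_ [[a b] [/= ha hb] <-]].
    by exists (a, b) => //; split; rewrite /= in_itv.
  by split; move: ha hb; rewrite /= !in_itv.
apply: continuous_compact; last first.
  by apply: compact_setX; exact: segment_compact.
apply: continuous_subspaceT => -[a b].
apply/cvgrPdist_le => eps eps0.
have [e e0 epsE] : exists2 e : R, 0 < e & eps = e%:C%C.
  move: eps0; case: eps => x y; rewrite ltcE/= => /andP[/eqP -> x0].
  by exists x.
have e20 : 0 < e / 2 by rewrite divr_gt0.
have na : \forall x \near nbhs (a : R^o), `|a - x| <= e / 2.
  by have /cvgrPdist_le := @cvg_id _ (nbhs (a : R^o)); apply.
have nb : \forall y \near nbhs (b : R^o), `|b - y| <= e / 2.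
  by have /cvgrPdist_le := @cvg_id _ (nbhs (b : R^o)); apply.
exists ([set x | `|a - x| <= e / 2], [set y | `|b - y| <= e / 2]) => //.
move=> [x y] [/= ax by_]; rewrite epsE [leLHS](normr_cmod ((a +i* b)%C - (x +i* y)%C)).
by rewrite lecR (le_trans (cmod_le_re_im _))//= (splitr e) lerD.
Qed.

Lemma closed_unit_square : closed (unit_square : set R[i]^o).
Proof.
by apply: compact_closed compact_unit_square; exact: norm_hausdorff.
Qed.

Lemma tame_complex (w : R -> R) : weight_generator w ->
  tame_field w (K := LFComplex R) (@cmod R).
Proof.
move=> hw.
pose Q r : set (complex_space R) := [set z | (`[- r, r]%classic : set R) (Re z) /\
    (`[- r, r]%classic : set R) (Im z)].
have sq r : (complex_lebesgue (Q r) < +oo)%E.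
  rewrite /Q complex_lebesgue_rectangle//= lebesgue_measure_itv/=.
  by case: ifP => _; rewrite ?mul0e ?ltry// -EFinD -EFinM ltry.
have mcell : measurable (unit_square : set (complex_space R)).
  rewrite (_ : unit_square = [set z | (`[0, 1]%classic : set R) (Re z) /\
    (`[0, 1]%classic : set R) (Im z)]).
    by apply: measurable_rectangle; exact: measurable_itv.
  by apply/seteqP; split => z /=; rewrite !in_itv.
have mball r : measurable ([set z | cmod z <= r] : set (complex_space R)).
  have [r0|r0] := ltP r 0.
    rewrite (_ : [set z | _] = set0)//; apply/seteqP; split => // z /=.
    by rewrite leNgt (lt_le_trans r0)// cmod_ge0.
  have := measurable_cmodX 1 cmeasurable_id measurableT (@measurable_itv R `]-oo, r ^+ 2]).
  rewrite setTI; congr measurable; apply/seteqP; split => z /=;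
    by rewrite in_itv/= muln1 ler_pXn2r// ?nnegrE ?cmod_ge0.
split.
- exact: cmod0.
- exact: cmod_ge0.
- exact: cmodD.
- exact: cmodM.
- exact: mball.
- move=> r; apply: le_lt_trans (sq r); apply: le_measure.
  + by apply/mem_set; exact: mball.
  + by apply/mem_set; apply: measurable_rectangle; exact: measurable_itv.
  move=> z /= zr; rewrite /Q /= !in_itv/= -!ler_norml.
  by split; apply: le_trans zr; [exact: normr_Re_le|exact: normr_Im_le].
- move=> [x1 x2] [y1 y2]; exact: real_charD.
- by move=> x; exact: cmod_real_char.
- move=> eta eta0; have [t t0 tP] := real_char_near1 eta0.
  by exists t => // x xt; apply: tP; apply: le_trans xt; exact: normr_Re_le.
- move=> p; apply: cmeasurable_real_char.
  suff [] : cmeasurable setT (fun xi : complex_space R => p.[xi] : R[i]) by [].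
  elim/poly_ind: p => [|p c IH].
    by under eq_fun do rewrite horner0; exact: cmeasurable_cst.
  under eq_fun do rewrite hornerMXaddC.
  apply: cmeasurableD; last exact: cmeasurable_cst.
  by apply: cmeasurableM => //; exact: cmeasurable_id.
- exact: compact_unit_square.
- exact: closed_unit_square.
- exact: mcell.
- apply: le_lt_trans (sq 1); apply: le_measure.
  + exact/mem_set.
  + by apply/mem_set; apply: measurable_rectangle; exact: measurable_itv.
  + move=> z [/andP[a0 a1] /andP[b0 b1]]; rewrite /Q /= !in_itv/= a1 b1.
    by rewrite !(le_trans _ a0, le_trans _ b0)// lerNl oppr0.
- move=> N0; pose N := maxn N0 1.
  have Ngt0 : (0 < N)%N by rewrite leq_max orbT.
  exists (N%:R^-1); first by exists N.
  pose rect i j : set R[i] := [set z | subinterval N i (Re z) /\ subinterval N j (Im z)].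
  have partE : fd_partition (data_of (LFComplex R)) N%:R^-1 =
      [set rect i j | i in `I_N & j in `I_N].
    rewrite /= real_partitionE//; apply/seteqP; split.
      by move=> _ [_ [i iN <-] [_ [j jN <-] <-]]; exists i => //; exists j.
    move=> _ [i iN [j jN <-]].
    by exists (subinterval N i); [exists i|exists (subinterval N j) => //; exists j].
  have rect_disj i j i' j' : rect i j `&` rect i' j' !=set0 -> i = i' /\ j = j'.
    move=> [z [[zi zj] [zi' zj']]]; split; apply: (@subinterval_disjoint R N) => //.
      by exists (Re z).
    by exists (Im z).
  have part_fin : finite_set (fd_partition (data_of (LFComplex R)) N%:R^-1).
    by rewrite partE; apply: finite_image2.
  split; first split => //.
  + move=> I J; rewrite partE => -[i iN [j jN <-]] [i' iN' [j' jN' <-]].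
    by move=> /rect_disj[-> ->].
  + move=> J; rewrite partE => -[i iN [j jN <-]]; split.
    * by apply: measurable_rectangle; exact: measurable_subinterval.
    * move=> z [/(subinterval_sub01 iN) + /(subinterval_sub01 jN)].
      by rewrite /= !in_itv.
    exists (i%:R * N%:R^-1 +i* (j%:R * N%:R^-1))%C => t t0.
    have t20 : 0 < t / 2 by rewrite divr_gt0.
    have [A [mA AJ At [a a0 Aa]]] := @subinterval_small R N i _ Ngt0 t20.
    have [B [mB BJ Bt [b b0 Bb]]] := @subinterval_small R N j _ Ngt0 t20.
    exists [set z | A (Re z) /\ B (Im z)]; split.
    * exact: measurable_rectangle.
    * by move=> z [/AJ ? /BJ ?].
    * move=> [x y] [/At xt /Bt yt]; apply: (le_trans (cmod_le_re_im _)).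
      by rewrite /= (splitr t) lerD.
    have -> : haar (LFComplex R) [set z | A (Re z) /\ B (Im z)] = (a * b)%:E.
      by rewrite EFinM -Aa -Bb -complex_lebesgue_rectangle.
    by rewrite lte_fin mulr_gt0//= ltry.
  + apply: (@size_fset_set_ge _ _ _ (fun i => rect i 0%N)) => //.
    * move=> i iN; rewrite partE; exists i; last by exists 0%N.
      by rewrite /= (leq_trans iN)// leq_maxl.
    * move=> i i' _ _ ii'; suff [] : i = i' /\ 0%N = 0%N by [].
      apply: rect_disj; exists (i%:R * N%:R^-1 +i* (0%:R * N%:R^-1))%C.
      by split; [|rewrite -ii']; split; exact: subinterval_left.
- move=> n delta sdelta; pose r := delta ^- n.
  have [mv [b b0 vb]] := schwartz_dilate_integrable hw (archimedean_scale_ge1 n sdelta).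
  have w0 x : 0 <= w x by case: hw.
  have [mvv vv] := integral_complex_lebesgue_prod mv mv (fun x => w0 (x / r))
    (fun x => w0 (x / r)) vb vb.
  exists (fun z : R[i] => w (Re z / r) * w (Im z / r)), (b * b); split => //.
  + by move=> z; rewrite mulr_ge0.
  + exact: mulr_gt0.
  + move=> x; rewrite /dilated_weight /= /real_weight -big_split/=.
    apply: eq_bigr => i _; rewrite !tnth_mktuple subr0.
    have -> : tnth x i / (delta ^- n)%:C%C = (Re (tnth x i) / r +i* (Im (tnth x i) / r))%C.
      rewrite /r -fmorphV; case: (tnth x i) => c d /=.
      by apply/eqP; rewrite eq_complex/= !mulr0 subr0 add0r !eqxx.
    by [].
Qed.

End TameComplex.

(** * Non-Archimedean local fields *)

Section Ultrametric.
Context {R : realType} (K : ultrametricField R).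
Implicit Types (x y z c : K) (r : R).
Local Notation abs := (@uf_abs R K).
Local Notation T := (ultrametric_space K).

Lemma uf_abs0 : abs 0 = 0.
Proof. by apply/eqP; rewrite uf_abs_eq0. Qed.

Lemma uf_abs1 : abs 1 = 1.
Proof.
have nz1 : abs 1 != 0 by rewrite uf_abs_eq0 oner_eq0.
by apply: (mulfI nz1); rewrite -uf_absM !mulr1.
Qed.

Lemma uf_absN x : abs (- x) = abs x.
Proof.
have absN1 : abs (-1) = 1.
  apply/eqP; rewrite -[_ == _](@pexpr_eq1 _ _ 2)// ?uf_abs_ge0//.
  by rewrite expr2 -uf_absM mulrNN mulr1 uf_abs1.
by rewrite -mulN1r uf_absM absN1 mul1r.
Qed.

Lemma uf_absB x y : abs (x - y) = abs (y - x).
Proof. by rewrite -opprB uf_absN. Qed.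

Lemma uf_absX x k : abs (x ^+ k) = abs x ^+ k.
Proof.
by elim: k => [|k IH]; rewrite ?expr0 ?uf_abs1// !exprS uf_absM IH.
Qed.

Lemma uf_absV x : abs x^-1 = (abs x)^-1.
Proof.
have [->|x0] := eqVneq x 0; first by rewrite invr0 uf_abs0 invr0.
have ax0 : abs x != 0 by rewrite uf_abs_eq0.
by apply: (mulfI ax0); rewrite -uf_absM !mulfV// uf_abs1.
Qed.

Lemma uf_abs_triangle x y : abs (x + y) <= abs x + abs y.
Proof.
by rewrite (le_trans (uf_absD _ _))// ge_max lerDl lerDr !uf_abs_ge0.
Qed.

Lemma uf_absD_le x y r : abs x <= r -> abs y <= r -> abs (x + y) <= r.
Proof. by move=> xr yr; rewrite (le_trans (uf_absD _ _))// ge_max xr. Qed.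

Definition cball c r : set T := [set x : K | abs (x - c) <= r].

(** Every point of an ultrametric ball is a centre. *)
Lemma cball_eq c c' r : abs (c - c') <= r -> cball c r = cball c' r.
Proof.
move=> cc'; rewrite /cball; apply/seteqP; split => x /= h.
  by rewrite -(subrKA c x (- c')) uf_absD_le.
by rewrite -(subrKA c' x (- c)) uf_absD_le// uf_absB.
Qed.

Lemma cball_meet c c' r : cball c r `&` cball c' r !=set0 -> cball c r = cball c' r.
Proof.
move=> [x [/= xc xc']]; apply: cball_eq.
by rewrite -(subrKA x c (- c')) uf_absD_le// uf_absB.
Qed.

Lemma uf_openP (U : set T) :
  (forall x, U x -> exists2 e : R, 0 < e & forall y, abs (y - x) <= e -> U y) -> open U.
Proof.
move=> Uex; rewrite openE => x /Uex[e e0 eU].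
apply/nbhs_ballP; exists e => // y; rewrite ballEmdist/= => xy.
by apply: eU; rewrite uf_absB ltW.
Qed.

Lemma closed_cball c r : closed (cball c r).
Proof.
rewrite -openC; apply: uf_openP => x /= /negP; rewrite -ltNge => rx.
exists ((abs (x - c) - r) / 2); first by rewrite divr_gt0// subr_gt0.
move=> y yx; apply/negP; rewrite -ltNge.
have : abs (x - c) <= abs (x - y) + abs (y - c).
  by rewrite -(subrKA y x (- c)) uf_abs_triangle.
by move: yx; rewrite uf_absB; lra.
Qed.

Lemma measurable_open_ultrametric (U : set T) : open U -> measurable U.
Proof. by move=> oU; exact: sub_sigma_algebra. Qed.

Lemma measurable_cball c r : measurable (cball c r).
Proof.
rewrite -[cball c r]setCK; apply: measurableC; apply: measurable_open_ultrametric.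
by rewrite openC; exact: closed_cball.
Qed.

Lemma cball_translate a c r : [set (a + x : K) | x in cball c r] = cball (a + c) r.
Proof.
apply/seteqP; split => [_ [x /= xc <-]|x /= xc].
  by rewrite /cball/= opprD addrACA subrr add0r.
exists (x - a); last by rewrite addrC subrK.
by rewrite /cball /= -addrA -opprD.
Qed.

End Ultrametric.

Section LocalField.
Context {R : realType} (K : nonarchLocalField R).
Local Notation abs := (@uf_abs R K).
Local Notation T := (ultrametric_space K).
Local Notation q := (uf_abs (na_pi K)).

Let q0 : 0 < q. Proof. exact: na_pi_gt0. Qed.
Let q1 : q < 1. Proof. exact: na_pi_lt1. Qed.
Let pi0 : na_pi K != 0. Proof. by rewrite -(@uf_abs_eq0 R K) gt_eqF. Qed.

(** By discreteness there is no absolute value strictly between that of the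
    uniformizer and [1]. *)
Lemma abs_lt1_le_pi (x : K) : abs x < 1 -> abs x <= q.
Proof.
have [->|x0] := eqVneq x 0; first by rewrite uf_abs0 ltW.
have [[[|k]|k] ->] := na_discrete x0.
- by rewrite expr0z ltxx.
- by move=> _; rewrite -exprnP exprS ler_piMr ?exprn_ile1// ltW.
rewrite NegzE -exprnN => /ltW; rewrite leNgt invf_gt1 ?exprn_gt0//.
by rewrite exprn_ilt1 /= ?(ltW q0)//.
Qed.

(** Expansion to [k] digits: approximate [x] by a representative of its residue
    class, divide the error by the uniformizer, and repeat. *)
Lemma ring_of_integers_covering k : exists s : seq K,
  forall x, abs x <= 1 -> exists2 y, y \in s & abs (x - y) <= q ^+ k.
Proof.
elim: k => [|k [s sP]].
  by exists [:: 0] => x x1; exists 0; rewrite ?mem_seq1// subr0 expr0.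
have [u uP] := na_residue_finite K.
exists [seq y + v * na_pi K ^+ k | y <- s, v <- u] => x x1.
have [y ys xy] := sP x x1.
have [|v vu xv] := uP ((x - y) / na_pi K ^+ k).
  by rewrite uf_absM uf_absV uf_absX ler_pdivrMr ?exprn_gt0// mul1r.
exists (y + v * na_pi K ^+ k); first by apply: allpairs_f.
have -> : x - (y + v * na_pi K ^+ k) = ((x - y) / na_pi K ^+ k - v) * na_pi K ^+ k.
  by rewrite mulrBl divfK ?expf_neq0// opprD addrA.
by rewrite uf_absM uf_absX exprS ler_wpM2r ?exprn_ge0 ?(ltW q0)// abs_lt1_le_pi.
Qed.

Lemma exists_expr_pi_le (t : R) : 0 < t -> exists k : nat, q ^+ k <= t.
Proof.
move=> t0.
have : (fun k => q ^+ k) @ \oo --> (0 : R) by apply: cvg_expr; rewrite ger0_norm ?ltW.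
move=> /cvgrPdist_le/(_ _ t0)[k _ kP]; exists k.
by have := kP k (leqnn k); rewrite /= sub0r normrN ger0_norm// exprn_ge0// ltW.
Qed.

(** Complete and totally bounded: an ultrafilter on the ring of integers contains
    one of the finitely many balls of radius [q ^ k] covering it, for every [k], so
    it is Cauchy. *)
Lemma compact_ring_of_integers : compact (ring_of_integers (K := K) : set T).
Proof.
rewrite compact_ultra => F UF FO.
have ballF k : exists x : K, F (cball x (q ^+ k)).
  have [s sP] := ring_of_integers_covering k.
  have : F [set x : T | exists2 y, y \in s & cball y (q ^+ k) x].
    by apply: filterS FO => x /sP.
  elim: s {sP} => [|y s IH].
    by move=> /filter_ex[x [y]]; rewrite in_nil.
  have [Fy _|Fy Fs] := in_ultra_setVsetC (cball y (q ^+ k)) UF; first by exists y.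
  apply: IH; apply: filterS (filterI Fy Fs) => x [nyx [z]].
  by rewrite inE => /orP[/eqP ->//|zs] zx; exists z.
have cF : cauchy F.
  apply: cauchy_exP => e e0.
  have [k kP] := exists_expr_pi_le (divr_gt0 e0 (ltr0n R 2)).
  have [x Fx] := ballF k; exists x; apply: filterS Fx => y /= yx.
  rewrite ballEmdist/= -[X in X < _]/(abs (x - y)) uf_absB (le_lt_trans yx)//.
  by rewrite (le_lt_trans kP)// ltr_pdivrMr// ltr_pMr// ltr1n.
have /cvg_ex[p Fp] := na_complete (@ultra_proper _ _ UF) cF.
exists p; split => //.
have cO : closed (cball (0 : K) 1) by exact: closed_cball.
have -> : ring_of_integers (K := K) = cball (0 : K) 1.
  by apply/seteqP; split => x /=; rewrite /cball/= subr0.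
apply: cO => B pB; apply: (filter_ex (F := F)).
apply: filterI (Fp _ pB).
by apply: filterS FO => x; rewrite /cball/= subr0.
Qed.

Context (mu : {measure set T -> \bar R}) (hmu : normalized_haar mu).

Lemma haar_cball c r : mu (cball (K := K) c r) = mu (cball (K := K) 0 r).
Proof.
rewrite -[RHS](proj1 hmu c _ (measurable_cball 0 r)).
by rewrite cball_translate addr0.
Qed.

Lemma haar_cball_covering (s : seq K) r1 r2 :
  (forall x : K, abs x <= r1 -> exists2 y, y \in s & abs (x - y) <= r2) ->
  (mu (cball (K := K) 0 r1) <= (size s)%:R%:E * mu (cball (K := K) 0 r2))%E.
Proof.
pose U (s : seq K) : set T := [set x : K | exists2 y, y \in s & cball y r2 x].
have [mU muU] : measurable (U s) /\ (mu (U s) <= (size s)%:R%:E * mu (cball (K := K) 0 r2))%E.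
  elim: s => [|y s [mU IH]].
    rewrite (_ : U [::] = set0); first by rewrite measure0 mul0e; split.
    by apply/seteqP; split => // x [y]; rewrite in_nil.
  have -> : U (y :: s) = cball y r2 `|` U s.
    apply/seteqP; split => [x [z]|x [yx|[z zs zx]]].
    - by rewrite inE => /orP[/eqP ->|zs] zx; [left|right; exists z].
    - by exists y => //; exact: mem_head.
    - by exists z => //; rewrite inE zs orbT.
  split; first by apply: measurableU => //; exact: measurable_cball.
  apply: (@le_trans _ _ (mu (cball y r2) + mu (U s))%E).
    by apply: measureU2 => //; exact: measurable_cball.
  rewrite haar_cball /= -natr1 EFinD ge0_muleDl ?lee_fin// mul1e addeC.
  exact: leeD2r.
move=> cover; apply: le_trans muU; apply: le_measure.
- by apply/mem_set; exact: measurable_cball.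
- exact/mem_set.
by move=> x; rewrite /cball /= subr0 => /cover[y ys xy]; exists y.
Qed.

Let haar1 : mu (cball (K := K) 0 1) = 1%E.
Proof.
rewrite -(proj2 hmu); congr (mu _).
by apply/seteqP; split => x /=; rewrite /cball/= subr0.
Qed.

(** The ring of integers has measure [1] and is covered by finitely many translates
    of the ball. *)
Lemma haar_cball_gt0 c k : (0 < mu (cball (K := K) c (q ^+ k)))%E.
Proof.
have [s sP] := ring_of_integers_covering k.
have := haar_cball_covering sP; rewrite haar1 haar_cball.
rewrite lt_neqAle measure_ge0 andbT; apply: contraTneq => <-.
by rewrite mule0 -ltNge lte01.
Qed.

(** Dividing a covering of the ring of integers by a power of the uniformizer
    covers a large ball by finitely many translates of the ring of integers. *)
Lemma haar_cball_lty c r : (mu (cball (K := K) c r) < +oo)%E.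
Proof.
have [k kP] : exists k, q ^+ k <= (Num.max r 1)^-1.
  by apply: exists_expr_pi_le; rewrite invr_gt0 lt_max ltr01 orbT.
have rk : r <= q ^- k.
  rewrite -[leLHS]invrK; have [r0|r0] := leP r 0.
    by rewrite invrK (le_trans r0)// invr_ge0 exprn_ge0// ltW.
  rewrite lef_pV2 ?posrE ?invr_gt0 ?exprn_gt0//.
  by rewrite (le_trans kP)// lef_pV2 ?posrE ?lt_max ?r0// le_max lexx.
have [s sP] := ring_of_integers_covering k.
rewrite haar_cball.
have : (mu (cball (K := K) 0 (q ^- k)) <=
    (size [seq y / na_pi K ^+ k | y <- s])%:R%:E * mu (cball (K := K) 0 1))%E.
  apply: haar_cball_covering => x xk.
  have [|y ys xy] := sP (x * na_pi K ^+ k).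
    by rewrite uf_absM uf_absX -ler_pdivlMr ?exprn_gt0// mul1r.
  exists (y / na_pi K ^+ k); first by apply: map_f.
  have -> : x - y / na_pi K ^+ k = (x * na_pi K ^+ k - y) / na_pi K ^+ k.
    by rewrite mulrBl mulfK// expf_neq0.
  by rewrite uf_absM uf_absV uf_absX ler_pdivrMr ?exprn_gt0// mul1r.
rewrite haar1 mule1 => h; apply: le_lt_trans (le_lt_trans h (ltry _)).
apply: le_measure.
- by apply/mem_set; exact: measurable_cball.
- by apply/mem_set; exact: measurable_cball.
by move=> x; rewrite /cball /= => xr; exact: le_trans rk.
Qed.

(** The powers of the uniformizer below the [k]-th lie in distinct pieces, so the number of
    pieces is at least the exponent of the scale. *)
Lemma cball_pi_powers i j k : (i < j < k)%N ->
  cball (na_pi K ^+ i) (q ^+ k) <> cball (na_pi K ^+ j) (q ^+ k).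
Proof.
move=> /andP[ij jk] eq_ij.
have : cball (na_pi K ^+ j) (q ^+ k) (na_pi K ^+ i).
  by rewrite -eq_ij /cball/= subrr uf_abs0 exprn_ge0// ltW.
rewrite /cball/=.
have -> : na_pi K ^+ i - na_pi K ^+ j = na_pi K ^+ i * (1 - na_pi K ^+ (j - i)).
  by rewrite mulrBr mulr1 -exprD subnKC// ltnW.
rewrite uf_absM uf_absX.
have lt1 : q ^+ (j - i) < 1 by rewrite exprn_ilt1 ?(ltW q0)// subn_eq0 -ltnNge ij.
have ge1 : 1 <= abs (1 - na_pi K ^+ (j - i)).
  rewrite leNgt; apply/negP => lt1'.
  have := uf_absD (1 - na_pi K ^+ (j - i)) (na_pi K ^+ (j - i)).
  rewrite subrK uf_abs1 leNgt gt_max lt1'/= uf_absX lt1; by [].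
have : q ^+ k < q ^+ i by rewrite ltr_iXn2l// (ltn_trans ij).
move=> ki /le_lt_trans/(_ ki).
by rewrite -[ltRHS]mulr1 ltr_pM2l ?exprn_gt0// ltNge ge1.
Qed.

Context (e : K -> R[i]) (he : normalized_character e).

(** The character is constant on the translates of the ring of integers, so the
    preimage of any set, measurable or not, is open. *)
Lemma measurable_char_poly (p : {poly K}) (S : set R[i]) :
  measurable ([set xi | S (e p.[xi])] : set T).
Proof.
have [eD _ _ e1 _] := he.
apply: measurable_open_ultrametric; apply: uf_openP => x Sx.
have [r r0 rP] := @abs_poly_continuous R K (@uf_abs R K) (uf_abs0 K) (@uf_abs_ge0 R K)
  (@uf_abs_triangle R K) (@uf_absM R K) p x 1 ltr01.
exists r => // y /rP yx.
by rewrite /= -(subrK p.[x] p.[y]) eD e1// mul1r.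
Qed.

Lemma tame_nonarch (w : R -> R) : tame_field w (K := LFNonarch hmu he) (@uf_abs R K).
Proof.
have [eD emod _ e1 _] := he.
have cellE : (ring_of_integers (K := K) : set T) = cball (0 : K) 1.
  by apply/seteqP; split => x /=; rewrite /cball/= subr0.
have ballE r : [set x : K | abs x <= r] = cball (0 : K) r.
  by apply/seteqP; split => x /=; rewrite /cball/= subr0.
split.
- exact: uf_abs0.
- exact: uf_abs_ge0.
- exact: uf_abs_triangle.
- exact: uf_absM.
- by move=> r; rewrite ballE; exact: measurable_cball.
- by move=> r; rewrite ballE; exact: haar_cball_lty.
- exact: eD.
- exact: emod.
- move=> eta eta0; exists 1 => // x x1.
  by rewrite [fd_char _ _]e1// subrr cmod0 ltW.
- by move=> p; split => _ Y mY; rewrite setTI;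
    [exact: (measurable_char_poly p (fun z => Y (complex.Re z)))|
     exact: (measurable_char_poly p (fun z => Y (complex.Im z)))].
- exact: compact_ring_of_integers.
- by rewrite /= cellE; exact: closed_cball.
- by rewrite /= cellE; exact: measurable_cball.
- by rewrite /= cellE; exact: haar_cball_lty.
- move=> k; exists (q ^+ k); first by exists k.
  have partE : fd_partition (data_of (LFNonarch hmu he)) (q ^+ k) =
    [set cball i (q ^+ k) | i in ring_of_integers (K := K)] by [].
  have part_fin : finite_set (fd_partition (data_of (LFNonarch hmu he)) (q ^+ k)).
    have [s sP] := ring_of_integers_covering k.
    apply: (@sub_finite_set _ _ [set cball y (q ^+ k) | y in [set` s]]).
      move=> _ [i /sP[y ys iy] <-]; exists y => //; apply/esym.
      exact: cball_eq.
    exact: finite_image.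
  split; first split => //.
  + by move=> _ _ [i _ <-] [j _ <-]; exact: cball_meet.
  + move=> _ [i iO <-]; split.
    * exact: measurable_cball.
    * move=> x /= xi; rewrite /ring_of_integers/= -(subrK i x) uf_absD_le//.
      by rewrite (le_trans xi)// exprn_ile1// ltW.
    exists i => t t0.
    have [m mt] := exists_expr_pi_le t0.
    exists (cball i (q ^+ maxn m k)); split.
    * exact: measurable_cball.
    * move=> x /= xi; apply: (le_trans xi); rewrite ler_wiXn2l ?(ltW q0) ?(ltW q1)//.
      exact: leq_maxr.
    * move=> x xi; apply: (le_trans xi); apply: le_trans mt.
      by rewrite ler_wiXn2l ?(ltW q0) ?(ltW q1)// leq_maxl.
    by rewrite [X in (X && _)]haar_cball_gt0 [X in (_ && X)]haar_cball_lty.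
  + apply: (@size_fset_set_ge _ _ _ (fun i => cball (na_pi K ^+ i) (q ^+ k))) => //.
    * move=> i ik; rewrite partE; exists (na_pi K ^+ i) => //.
      by rewrite /ring_of_integers/= uf_absX exprn_ile1// ltW.
    * move=> i j; rewrite !inE => ik jk eq_ij.
      have [ij|ji|//] := ltngtP i j.
        by case: (@cball_pi_powers i j k) => //; rewrite ij.
      by case: (@cball_pi_powers j i k) => //; rewrite ji.
- move=> n delta [s _ <-]; pose r := (q ^+ s) ^- n.
  have r0 : 0 < r by rewrite invr_gt0 !exprn_gt0.
  have r1 : 1 <= r by rewrite /r invf_ge1 ?exprn_gt0// !exprn_ile1 ?exprn_ge0// ltW.
  pose B : set T := cball (0 : K) r.
  have mB : measurable B by exact: measurable_cball.
  exists (\1_B : T -> R), (fine (mu B)); split.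
  + exact: measurable_indic.
  + by move=> x; rewrite indicE.
  + rewrite fine_gt0// haar_cball_lty andbT.
    apply: lt_le_trans (haar_cball_gt0 0 0) _; apply: le_measure.
    * by apply/mem_set; exact: measurable_cball.
    * exact/mem_set.
    by move=> x; rewrite /B /cball/= expr0 => /le_trans; apply.
  + transitivity (\int[mu]_x (\1_B x)%:E)%E; first by [].
    rewrite integral_indic// setIT fineK// ge0_fin_numE//.
    exact: haar_cball_lty.
  + move=> x; rewrite /dilated_weight /=.
    have absr : abs (xget 1 [set a : K | abs a = r]) = r.
      have := @xgetPex _ 1 [set a : K | abs a = r]; apply.
      by exists ((na_pi K ^+ s) ^- n); rewrite /= uf_absV !uf_absX.
    set a := xget _ _ in absr *.
    have BE t : B t <-> abs ((t - 0) / a) <= 1.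
      by rewrite /B /cball/= uf_absM uf_absV absr ler_pdivrMr// mul1r.
    have [xB|/existsNP[i xi]] := pselect (forall i, B (tnth x i)).
      rewrite indicE mem_set => [|i]; last first.
        by rewrite tnth_mktuple tnth_mktuple -BE; exact: xB.
      by rewrite big1// => i _; rewrite indicE mem_set.
    rewrite indicE memNset => [|/(_ i)]; last first.
      by rewrite tnth_mktuple tnth_mktuple -BE.
    by rewrite (bigD1 i)//= indicE memNset// mul0r.
Qed.

End LocalField.

Theorem theorem2 (R : realType) (w : R -> R) (hw : weight_generator w)
    (n : nat) (hn : (2 <= n)%N) (K : local_field R) (gamma : n.-tuple {poly K}) :
  ((n`!%:R `^ (2 * n)%:R^-1)%:E <= square_function_constant gamma w)%E.
Proof.
have n0 : (0 < n)%N by exact: ltnW.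
case: K gamma => [||K mu e hmu he] gamma.
- exact: (tame_square_function_constant (tame_real hw) n0).
- exact: (tame_square_function_constant (tame_complex hw) n0).
- exact: (tame_square_function_constant (tame_nonarch hmu he w) n0).
Qed.
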